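(* Let $k<\frac{n}{2}$ be two positive integers and let $g=\gcd(n,k)$. The $(n,k)$-wreath matrix $M(n,k)$ has $k+1$ eigenvalues $$\lambda_1\geq\lambda_2,\lambda_3,\ldots,\lambda_k>\lambda_0=0$$ (that is, $\lambda_1\ge\lambda_l>0$ for each $2\le l\le k$, $\lambda_1>0$, and $\lambda_0=0$), all of which are integers. The multiplicity of $\lambda_1$ is $1$. The multiplicity of $\lambda_l$ is $\binom{n}{l}-\binom{n}{l-1}$ for $2\leq l\leq k$. The $k+1$ eigenvalues are not claimed to be pairwise distinct: if some of them are equal, the multiplicity of an eigenvalue $\lambda$ is the sum of the multiplicities listed for those $\lambda_l$ with $\lambda_l=\lambda$. The value of $\lambda_1$ is $\frac{n(n-k)!\,k!}{2g(g!)^{n/g}}$ if $k\nmid n$ and $\frac{n^2(n-k)!}{k^2(k!)^{n/k-1}(\frac{n}{k})!}$ if $k\mid n$. If $g=1$, then for $2\leq l\leq k$ we moreover have $$\lambda_l=(-1)^l\frac{1}{2}\,l!\,k!\,(n-k-l)!\,(n-2k-1)\binom{k}{l}-\frac{1}{2}k!\,(n-k)!+l!\binom{k+1}{l+1}\sum_{j=0}^{l}(-1)^{l-j}(k-j)!\,(n-k-l+j)!.$$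
   Context: For positive integers $k\le n$, $\mathbb{Z}_n$ is the set of integers modulo $n$ and $\mathbb{Z}_n^{(k)}$ is the set of subsets of $\mathbb{Z}_n$ of size $k$. For a bijection $\pi:\mathbb{Z}_n\to\mathbb{Z}_n$, the $(n,k,\pi)$-wreath is the family $\mathcal{F}_\pi=\{\{\pi((i-1)k+1),\pi((i-1)k+2),\ldots,\pi(ik)\} : i\in\mathbb{Z}_n\}\subset\mathbb{Z}_n^{(k)}$ (arguments of $\pi$ taken modulo $n$). An $(n,k)$-wreath is a family of the form $\mathcal{F}_\pi$ for some such $\pi$, and $\mathcal{W}_{n,k}$ is the set of all $(n,k)$-wreaths (two permutations giving the same family give the same wreath). The $(n,k)$-wreath matrix $M=M(n,k)$ is the square matrix with rows and columns labelled by $\mathcal{W}_{n,k}$ and entries $M_{\mathcal{F},\mathcal{F}'}=|\mathcal{F}\cap\mathcal{F}'|$.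
   Formalization: That λ_0 = 0 is an eigenvalue is claimed only for k ≥ 2, since for k = 1 there is a single wreath and M(n,1) is the 1×1 matrix (n), which does not have the eigenvalue 0; all other claims are kept for k = 1. *)

(* Defs.v *)
From HB Require Import structures.
From mathcomp Require Import all_boot all_order all_fingroup all_algebra.

Set Implicit Arguments.
Unset Strict Implicit.
Unset Printing Implicit Defensive.

Import GRing.Theory.

Local Open Scope ring_scope.

(* 'Z_n is the ring of integers modulo n only for 1 < n; wreaths are only used
   for 0 < k and 2k < n, hence 2 < n. All arguments of pi below are computed
   in 'Z_n, i.e. modulo n. *)

(* {pi((i-1)k+1), ..., pi(ik)}; the index j : 'I_k is shifted by one. *)
Definition wreath_block (n k : nat) (pi : {perm 'Z_n}) (i : 'Z_n) : {set 'Z_n} :=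
  [set pi ((i - 1) * k%:R + j.+1%:R) | j : 'I_k].

Definition wreath (n k : nat) (pi : {perm 'Z_n}) : {set {set 'Z_n}} :=
  [set wreath_block k pi i | i : 'Z_n].

Definition wreaths (n k : nat) : {set {set {set 'Z_n}}} :=
  [set wreath k pi | pi : {perm 'Z_n}].

Definition wreath_matrix (R : nzRingType) (n k : nat) : 'M[R]_#|wreaths n k| :=
  \matrix_(a, b) #|enum_val a :&: enum_val b|%:R.

(* Listed multiplicity of lambda_l, for 1 <= l <= k < n/2; the subtraction does
   not truncate in this range. *)
Definition wreath_mult (n l : nat) : nat :=
  if l == 1%N then 1%N else ('C(n, l) - 'C(n, l.-1))%N.

(* Main.v *)
Require Import Defs.
From HB Require Import structures.
From mathcomp Require Import all_boot all_order all_fingroup all_algebra.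
From mathcomp Require Import zify ring lra.

(** Let N be the incidence matrix between wreaths and k-subsets. The wreath
matrix is N N^T, so away from 0 it has the eigenvalues, with multiplicities,
of T = N^T N, whose entry at (A, B) is the number of wreaths containing both
A and B.

The wreaths form one orbit of families under the symmetric group. Let e_S be
the function B |-> [S is a subset of B] on k-subsets. The value of T e_S at B
depends only on #|S| and #|S :&: B|; expanding this value in binomial
coefficients of #|S :&: B| shows that T e_S is theta_l e_S plus a combination
of functions e_R with R a proper subset of S, where l = #|S| and theta_l is a
finite difference of integers [inclusion_gram_theta]. Thus T is triangular
for the filtration by the spans V_l of the e_S with #|S| = l; since T is
symmetric, it acts as the scalar theta_l on the orthogonal complement of
V_(l-1) in V_l [layer_eigen]. For l <= k <= n - l the functions e_S with
#|S| = l are linearly independent [inclusion_sums_injective], which gives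
the multiplicities C(n, l) - C(n, l-1).

What remains is to find the theta_l. The products over l disjoint pairs
(x, y) of the functions [x in B] - [y in B] are eigenvectors for theta_l.
As every point lies in equally many blocks of a wreath, N kills them for
l = 1, so theta_1 = 0. For l >= 2 the pairs can be placed on the circle so
that a single block of one wreath contributes, so N does not kill them and
theta_l > 0 [model_theta_gt0]; evaluating at one k-subset gives
theta_l <= theta_0. Hence lambda_1 is theta_0 and lambda_l is theta_l for
l >= 2.

The explicit values come from counting permutations instead of wreaths, each
wreath being counted as often as its stabilizer has elements. Let
g = gcd(n, k). Cut the circle of n positions into n/g atoms of g consecutive
positions; the blocks are the windows of k/g consecutive atoms. The
stabilizer permutes the atoms, and the positions within each atom freely
[card_stab_lift]. On the atoms it is the full symmetric group if k = g, and
dihedral otherwise [card_window_stab]. For lambda_1 it is enough to count the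
pairs of blocks; for g = 1 the other eigenvalues require a sum over the overlaps
of two windows, in which a Vandermonde identity [sum_bin_bin] makes the main
term independent of the index of the finite difference up to factorials.

Finally 0 is an eigenvalue as soon as k > 1: the alternating sum of the
images of one wreath under the permutations of three points is killed by N,
since every set has two of the three points on the same side, and it is
nonzero for three points of different atoms [eigenvalue0]. *)

Set Implicit Arguments.
Unset Strict Implicit.
Unset Printing Implicit Defensive.

Import Order.TTheory GRing.Theory Num.Theory.

(** * Eigenspaces from a filtration *)

Local Open Scope ring_scope.

(** Multiplication by [A] maps one eigenspace into the other, and it is injective
because multiplying further by [B] gives back the original up to the factor [a]. *)
Lemma rank_eigenspace_mulmxC_le (F : fieldType) (m n : nat)
    (A : 'M[F]_(m, n)) (B : 'M[F]_(n, m)) (a : F) :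
  a != 0 -> (\rank (eigenspace (A *m B) a) <= \rank (eigenspace (B *m A) a))%N.
Proof.
move=> a0; set E := eigenspace (A *m B) a.
have EAB : E *m A *m B = a *: E by rewrite -mulmxA; apply/eigenspaceP.
have EA : (E *m A <= eigenspace (B *m A) a)%MS.
  by apply/eigenspaceP; rewrite mulmxA EAB scalemxAl.
apply: leq_trans (mxrankS EA).
by rewrite -(mxrank_scale_nz E a0) -EAB mxrankM_maxl.
Qed.

Lemma rank_eigenspace_mulmxC (F : fieldType) (m n : nat)
    (A : 'M[F]_(m, n)) (B : 'M[F]_(n, m)) (a : F) :
  a != 0 -> \rank (eigenspace (A *m B) a) = \rank (eigenspace (B *m A) a).
Proof.
by move=> a0; apply/anti_leq/andP; split; exact: rank_eigenspace_mulmxC_le.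
Qed.

(** The dot product is taken without conjugation, so that this is a complement only
over an ordered field. *)
Definition orthocomp (F : fieldType) (m n : nat) (A : 'M[F]_(m, n)) : 'M[F]_n :=
  kermx A^T.

Lemma row_sqr_eq0 (F : realFieldType) (n : nat) (v : 'rV[F]_n) :
  v *m v^T = 0 -> v = 0.
Proof.
move=> /matrixP/(_ 0 0); rewrite !mxE => /eqP.
rewrite psumr_eq0 => [/allP v0|i _]; last by rewrite mxE -expr2 sqr_ge0.
apply/rowP => i; rewrite mxE; apply/eqP.
by have := v0 i (mem_index_enum i); rewrite mxE mulf_eq0 orbb.
Qed.

Lemma capmx_ortho (F : realFieldType) (m n : nat) (A : 'M[F]_(m, n)) :
  (A :&: orthocomp A = 0)%MS.
Proof.
apply/row_matrixP => i; rewrite row0; set v := row i _.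
have : (v <= A :&: orthocomp A)%MS by apply: row_sub.
rewrite sub_capmx => /andP[/submxP[w vwA] /sub_kermxP vA].
by apply: row_sqr_eq0; rewrite {2}vwA trmx_mul mulmxA vA mul0mx.
Qed.

Lemma addmx_ortho_full (F : realFieldType) (m n : nat) (A : 'M[F]_(m, n)) :
  row_full (A + orthocomp A)%MS.
Proof.
rewrite /row_full mxrank_disjoint_sum ?capmx_ortho // mxrank_ker mxrank_tr.
by rewrite subnKC // rank_leq_col.
Qed.

Section Filtration.
Variables (F : realFieldType) (N k : nat) (T : 'M[F]_N).
Variables (V : nat -> 'M[F]_N) (th : nat -> F).
Hypothesis T_sym : T^T = T.
Hypothesis V0 : V 0%N = 0.
Hypothesis V_mono : forall l, (l <= k)%N -> (V l <= V l.+1)%MS.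
Hypothesis V_tri :
  forall l, (l <= k)%N -> (V l.+1 *m (T - (th l)%:M) <= V l)%MS.
Hypothesis V_full : row_full (V k.+1).

Definition layer (l : nat) : 'M[F]_N := (V l.+1 :&: orthocomp (V l))%MS.

Lemma filtration_stable l : (l <= k.+1)%N -> (V l *m T <= V l)%MS.
Proof.
case: l => [|l] lk; first by rewrite V0 mul0mx.
have -> : T = (T - (th l)%:M) + (th l)%:M by rewrite subrK.
rewrite mulmxDr addmx_sub ?mul_mx_scalar ?scalemx_sub //.
by rewrite (submx_trans (V_tri lk)) ?V_mono.
Qed.

(** [T - th l] maps the layer into [V l] because [V] is triangular, and into the
orthogonal complement of [V l] because [T] is symmetric. These meet in 0. *)
Lemma layer_eigen l : (l <= k)%N -> (layer l <= eigenspace T (th l))%MS.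
Proof.
move=> lk; rewrite /layer /eigenspace; set U := (_ :&: _)%MS.
apply/sub_kermxP/eqP; rewrite -submx0 -(capmx_ortho (V l)) sub_capmx.
apply/andP; split.
  by rewrite (submx_trans _ (V_tri lk)) ?submxMr ?capmxSl.
have /sub_kermxP UV : (U <= orthocomp (V l))%MS by apply: capmxSr.
apply/sub_kermxP; rewrite mulmxBr mulmxBl mul_mx_scalar -scalemxAl UV scaler0.
rewrite subr0 -mulmxA -{1}T_sym -trmx_mul.
have /submxP[D ->] := filtration_stable (leqW lk).
by rewrite trmx_mul mulmxA UV mul0mx.
Qed.

Lemma filtration_step l : (l <= k)%N -> (V l + layer l :=: V l.+1)%MS.
Proof.
move=> lk; rewrite /layer capmxC.
apply: eqmx_trans (matrix_modl _ (V_mono lk)) _.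
apply/eqmxP; rewrite capmxSr sub_capmx submx_refl andbT.
exact/submx_full/addmx_ortho_full.
Qed.

Lemma rank_layer l :
  (l <= k)%N -> \rank (layer l) = (\rank (V l.+1) - \rank (V l))%N.
Proof.
move=> lk; rewrite -(filtration_step lk) mxrank_disjoint_sum ?addKn //.
apply/eqP; rewrite -submx0 -(capmx_ortho (V l)) sub_capmx capmxSl /=.
by rewrite (submx_trans (capmxSr _ _)) ?capmxSr.
Qed.

Lemma sum_layers : (\sum_(l < k.+1) layer l :=: 1%:M)%MS.
Proof.
suff H j : (j <= k.+1)%N -> (\sum_(l < j) layer l :=: V j)%MS.
  by apply: eqmx_trans (H _ (leqnn _)) _; apply/eqmxP; rewrite submx1 sub1mx.
elim: j => [|j IH] jk; first by rewrite big_ord0 V0.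
rewrite big_ord_recr /=.
by apply: eqmx_trans (filtration_step jk); apply: adds_eqmx;
  first exact: IH (ltnW jk).
Qed.

Lemma sum_rank_layers : (\sum_(l < k.+1) \rank (layer l))%N = N.
Proof.
suff H j : (j <= k.+1)%N -> (\sum_(l < j) \rank (layer l))%N = \rank (V j).
  by rewrite H //; apply/eqP.
elim: j => [|j IH] jk; first by rewrite big_ord0 V0 mxrank0.
rewrite big_ord_recr /= IH ?(ltnW jk) // rank_layer // subnKC //.
exact/mxrankS/V_mono.
Qed.
End Filtration.

(** The [U l] with [th l = a] lie in the kernel of [T - a], the other ones in its
image; both inclusions are equalities because the ranks add up to [N]. *)
Lemma rank_eigenspace_decomp (F : fieldType) (N p : nat) (T : 'M[F]_N)
    (U : 'I_p -> 'M[F]_N) (th : 'I_p -> F) (a : F) :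
    (\sum_l U l :=: 1%:M)%MS -> (\sum_l \rank (U l))%N = N ->
    (forall l, U l <= eigenspace T (th l))%MS ->
  \rank (eigenspace T a) = (\sum_(l | th l == a) \rank (U l))%N.
Proof.
move=> sumU rkU eigU.
have dirU : mxdirect (\sum_l U l) by apply/mxdirectP; rewrite /= sumU mxrank1.
have rk P : \rank (\sum_(l | P l) U l)%MS = (\sum_(l | P l) \rank (U l))%N.
  apply/anti_leq/andP; split; first exact: mxrank_sum_leqif.
  have e : (\sum_(l | P l) \rank (U l) + \sum_(l | ~~ P l) \rank (U l))%N
           = \rank (\sum_(l | P l) U l + \sum_(l | ~~ P l) U l)%MS.
    have rkN : \rank (\sum_l U l)%MS = N by rewrite sumU mxrank1.
    by move: rkU rkN; rewrite !(bigID P predT) /= => -> ->.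
  have le1 := mxrank_adds_leqif (\sum_(l | P l) U l)%MS (\sum_(l | ~~ P l) U l)%MS.
  have le2 : (\rank (\sum_(l | ~~ P l) U l)%MS
              <= \sum_(l | ~~ P l) \rank (U l))%N by apply: mxrank_sum_leqif.
  rewrite -(leq_add2r (\sum_(l | ~~ P l) \rank (U l))) e.
  by rewrite (leq_trans (leq_of_leqif le1)) // leq_add2l.
have le1 : (\sum_(l | th l == a) U l <= eigenspace T a)%MS.
  by apply/sumsmx_subP => l /eqP <-.
have le2 : (\sum_(l | th l != a) U l <= T - a%:M)%MS.
  apply/sumsmx_subP => l /= tha; rewrite -(eqmx_scale (U l) (_ : th l - a != 0))
    ?subr_eq0 //.
  have /eigenspaceP UT := eigU l.
  apply/submxP; exists (U l).
  by rewrite mulmxBr UT mul_mx_scalar scalerBl.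
have := mxrankS le1; have := mxrankS le2; rewrite !rk => h2 h1.
have rkT := rank_leq_row (T - a%:M).
apply/anti_leq; rewrite h1 andbT.
rewrite /eigenspace mxrank_ker leq_subLR.
have := rkU; rewrite (bigID (fun l => th l == a)) /= addnC => e.
by rewrite -{1}e leq_add2r.
Qed.

(** The layers are built over an ordered field and then moved along [f], since over
[R], which may contain nonreal numbers, a space can meet its orthogonal. *)
Lemma rank_eigenspace_filtration (F : realFieldType) (R : fieldType)
    (f : {rmorphism F -> R}) (N k : nat)
    (T : 'M[F]_N) (V : nat -> 'M[F]_N) (th : nat -> F) (a : R) :
    T^T = T -> V 0%N = 0 ->
    (forall l, (l <= k)%N -> (V l <= V l.+1)%MS) ->
    (forall l, (l <= k)%N -> (V l.+1 *m (T - (th l)%:M) <= V l)%MS) ->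
    row_full (V k.+1) ->
  \rank (eigenspace (map_mx f T) a)
  = (\sum_(l < k.+1 | f (th l) == a) (\rank (V l.+1) - \rank (V l)))%N.
Proof.
move=> T_sym V0 V_mono V_tri V_full.
pose U (l : 'I_k.+1) : 'M[R]_N := map_mx f (layer V l).
rewrite (@rank_eigenspace_decomp _ _ _ _ U (fun l => f (th l))).
- apply: eq_bigr => l _; rewrite mxrank_map; apply: rank_layer V_mono _ _.
  by rewrite -ltnS.
- have e : (\sum_l U l :=: map_mx f (\sum_(l < k.+1) layer V l)%MS)%MS.
    apply: (big_rec2 (fun A B => (A :=: map_mx f B)%MS)) => [|l A B _ AB];
      first by rewrite map_mx0.
    by apply: eqmx_trans (eqmx_sym (map_addsmx _ _ _)); apply: adds_eqmx.
  apply: eqmx_trans e _; rewrite -(map_mx1 f).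
  by apply/map_eqmx/sum_layers.
- by rewrite -[RHS](sum_rank_layers V0 V_mono V_full); apply: eq_bigr => l _;
  rewrite mxrank_map.
- move=> l; have lk : (l <= k)%N by rewrite -ltnS.
  have /eigenspaceP e := layer_eigen T_sym V0 V_mono V_tri lk.
  by apply/eigenspaceP; rewrite -map_mxM e map_mxZ.
Qed.

Local Close Scope ring_scope.

(** * Counting permutations with prescribed images *)

Section PermCount.
Variable X : finType.
Implicit Types (P Q B S : {set X}) (s : {perm X}).

Lemma imset_permM s1 s2 P : (s1 * s2)%g @: P = s2 @: (s1 @: P).
Proof. by rewrite -imset_comp; apply: eq_imset => x; rewrite /= permM. Qed.

Lemma card_imset_perm s P : #|s @: P| = #|P|.
Proof. exact/card_imset/perm_inj. Qed.

Lemma imset_perm1 P : (1%g : {perm X}) @: P = P.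
Proof. by rewrite -[RHS]imset_id; apply: eq_imset => x; rewrite perm1. Qed.

Lemma imset_permK s P : s^-1%g @: (s @: P) = P.
Proof. by rewrite -imset_permM mulgV imset_perm1. Qed.

Lemma imset_permKV s P : s @: (s^-1%g @: P) = P.
Proof. by rewrite -imset_permM mulVg imset_perm1. Qed.

Lemma mem_imset_perm s P x : (x \in s @: P) = ((s^-1)%g x \in P).
Proof. by rewrite -{1}(permKV s x) mem_imset //; apply: perm_inj. Qed.

Lemma tperm_imset_id x y P : (x \in P) = (y \in P) -> tperm x y @: P = P.
Proof.
move=> xy; apply/setP => z; rewrite mem_imset_perm tpermV.
by case: tpermP => [->|->|].
Qed.

Lemma subset_imset_perm s P Q : (s @: P \subset s @: Q) = (P \subset Q).
Proof.
apply/idP/idP => [/(imsetS (s^-1)%g)|/imsetS//].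
by rewrite !imset_permK.
Qed.

Definition constrained_perms P Q B S : {set {perm X}} :=
  [set s : {perm X} | (s @: P == B) && (S \subset s @: Q)].

(** Exchanging two points of [B :\: S] shows that each of them lies in [s @: Q] for
equally many [s]; and for each [s] exactly [#|P :&: Q| - #|S :&: B|] of them do. *)
Lemma card_constrained_permsU1 P Q B S x : x \in B -> x \notin S ->
  (#|B| - #|S :&: B|) * #|constrained_perms P Q B (x |: S)|
  = (#|P :&: Q| - #|S :&: B|) * #|constrained_perms P Q B S|.
Proof.
move=> xB xS; pose A y := constrained_perms P Q B (y |: S).
have Aswap y : y \in B :\: S -> #|A y| = #|A x|.
  rewrite inE => /andP[yS yB]; pose t := tperm x y.
  have BE : t @: B = B by apply: tperm_imset_id; rewrite xB yB.
  have SE : t @: S = S.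
    by apply: tperm_imset_id; rewrite (negbTE xS) (negbTE yS).
  have xSE : t @: (x |: S) = y |: S by rewrite imsetU1 SE tpermL.
  rewrite -(card_imset (A x) (mulIg t)); apply: eq_card => s.
  have -> : s = (s * t^-1 * t)%g by rewrite mulgKV.
  move: (s * t^-1)%g => {}s; rewrite (mem_imset _ _ (mulIg t)) !inE imset_permM
    -{1}BE.
  by rewrite (inj_eq (imset_inj perm_inj)) imset_permM -xSE subset_imset_perm.
have -> : #|B| - #|S :&: B| = #|B :\: S| by rewrite cardsD setIC.
have -> : #|B :\: S| * #|A x| = \sum_(y in B :\: S) #|A y|.
  by rewrite (eq_bigr _ Aswap) sum_nat_const.
have cardA y : #|A y| = \sum_(s in constrained_perms P Q B S) (y \in s @: Q).
  rewrite -sum1_card big_mkcond [RHS]big_mkcond; apply: eq_bigr => s _.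
  rewrite !inE subUset sub1set.
  by case: (_ == _); case: (y \in _); case: (S \subset _).
rewrite (eq_bigr _ (fun y _ => cardA y)) exchange_big /= mulnC -sum_nat_const.
apply: eq_bigr => s; rewrite inE => /andP[/eqP sPB SsQ].
have -> : #|P :&: Q| = #|B :&: s @: Q|.
  by rewrite -sPB -imsetI ?card_imset_perm // => ? ? _ _ /perm_inj.
have -> : #|S :&: B| = #|(B :&: s @: Q) :&: (S :&: B)|.
  by congr #|pred_of_set _|; apply/esym/setIidPr; rewrite setIC setIS.
rewrite -cardsD -sum1_card big_mkcond [RHS]big_mkcond; apply: eq_bigr => y _.
by rewrite !inE; case: (y \in B); case: (y \in S); case: (y \in s @: Q).
Qed.

(** This turns the points of [S] outside [B] into points inside, so that the same
recursion applies to them. *)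
Lemma constrained_permsC P Q B S :
  constrained_perms (~: P) Q (~: B) S = constrained_perms P Q B S.
Proof.
apply/setP => s; rewrite !inE; congr (_ && _).
suff -> : s @: (~: P) = ~: (s @: P) by rewrite (inj_eq (can_inj (@setCK _))).
by apply/setP => x; rewrite !(inE, mem_imset_perm).
Qed.

Lemma card_constrained_perms_rec P Q B S : #|P| = #|B| ->
  #|B| ^_ #|S :&: B| * #|~: B| ^_ #|S :\: B| * #|constrained_perms P Q B S|
  = #|P :&: Q| ^_ #|S :&: B| * #|Q :\: P| ^_ #|S :\: B|
    * #|constrained_perms P Q B set0|.
Proof.
move=> cPB; have cPBc : #|~: P| = #|~: B|.
  by have := cardsC P; have := cardsC B; lia.
have step a b c d u v A A' A0 :
    a * b * A' = c * d * A0 -> u * A = v * A' -> a * u * b * A = c * v * d * A0.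
  move=> h1 h2; have -> : a * u * b * A = a * b * (u * A) by ring.
  by rewrite h2 mulnCA h1; ring.
elim: {S}#|S| {-2}S (erefl #|S|) => [|c IH] S cS.
  by have /eqP -> : S == set0; rewrite -?cards_eq0 ?cS // set0I set0D cards0
    !ffactn0.
have [x xS] : exists x, x \in S by apply/set0Pn; rewrite -cards_eq0 cS.
pose S' := S :\ x; have SE : S = x |: S' by rewrite setD1K.
have xS' : x \notin S' by rewrite !inE eqxx.
have cS' : #|S'| = c by move: (cardsD1 x S); rewrite xS cS => -[].
have {}IH := IH _ cS'; have [xB|xB] := boolP (x \in B).
- have -> : S :&: B = x |: (S' :&: B) by rewrite SE setIUl (setIidPl _) ?sub1set.
  have -> : S :\: B = S' :\: B.
    by rewrite SE setDUl (_ : [set x] :\: B = set0) ?set0U //; apply/eqP;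
      rewrite setD_eq0 sub1set.
  rewrite cardsU1 !inE eqxx /= !ffactnSr.
  have := card_constrained_permsU1 P Q xB xS'; rewrite -SE.
  exact: step IH.
- have xBc : x \in ~: B by rewrite inE.
  have -> : S :&: B = S' :&: B.
    by rewrite SE setIUl (_ : [set x] :&: B = set0) ?set0U //; apply/eqP;
      rewrite setI_eq0 disjoints1.
  have -> : S :\: B = x |: (S' :\: B).
    by rewrite SE setDUl !setDE (setIidPl _) ?sub1set.
  rewrite cardsU1 !inE eqxx andbF /= !ffactnSr.
  have := card_constrained_permsU1 (~: P) Q xBc xS';
    rewrite -SE !constrained_permsC.
  rewrite ![_ :&: ~: B]setIC ![~: B :&: _]setIC -!setDE [~: P :&: Q]setIC -setDE.
  rewrite [#|B| ^_ _ * _]mulnC [#|P :&: Q| ^_ _ * _]mulnC; apply: step.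
  by rewrite [#|~: B| ^_ _ * _]mulnC [#|Q :\: P| ^_ _ * _]mulnC; exact: IH.
Qed.

(** The points of [S] are added one at a time. The number of permutations mapping
[P] onto [B], from which this starts, is itself obtained by adding the points of
[B], with [setT] in the place of both [P] and [B]. *)
Lemma card_constrained_perms P Q B S : #|P| = #|B| ->
  #|constrained_perms P Q B S|
  = #|P :&: Q| ^_ #|S :&: B| * #|Q :\: P| ^_ #|S :\: B|
    * ((#|B| - #|S :&: B|)`! * (#|X| - #|B| - #|S :\: B|)`!).
Proof.
move=> cPB.
have card0 : #|constrained_perms P Q B set0| = #|B|`! * (#|X| - #|B|)`!.
  have := @card_constrained_perms_rec setT P setT B erefl.
  rewrite setIT setTI !setDT !cards0 !ffactn0 !muln1.
  have -> : constrained_perms setT P setT B = constrained_perms P Q B set0.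
    apply/setP => s; rewrite !inE sub0set andbT.
    rewrite eqEcard subsetT cardsT card_imset_perm cardsT leqnn /=.
    by rewrite eq_sym eqEcard card_imset_perm cPB leqnn andbT.
  have -> : constrained_perms setT P setT set0 = setT.
    apply/setP => s; rewrite !inE sub0set andbT.
    by rewrite eqEcard subsetT card_imset_perm leqnn.
  have -> : #|[set: {perm X}]| = #|X|`!.
    rewrite -[in RHS]cardsT -card_perm; apply: eq_card => s; rewrite inE.
    by apply/esym/subsetP => x _; rewrite inE.
  rewrite cardsT cPB ffactnn; have cB := max_card (mem B).
  rewrite -(ffact_fact cB) => e; apply/eqP.
  by rewrite -(eqn_pmul2l (m := #|X| ^_ #|B|)) ?ffact_gt0 // e; apply/eqP; ring.
have := card_constrained_perms_rec Q S cPB; rewrite card0.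
have le1 : #|S :&: B| <= #|B| by apply/subset_leq_card/subsetIr.
have le2 : #|S :\: B| <= #|~: B| by rewrite setDE; apply/subset_leq_card/subsetIr.
have -> : #|X| - #|B| = #|~: B| by rewrite -(cardsC B) addKn.
rewrite -(ffact_fact le1) -(ffact_fact le2) => e.
apply/eqP; rewrite -(eqn_pmul2l (m := #|B| ^_ #|S :&: B| * #|~: B| ^_ #|S :\:
  B|)); last by rewrite muln_gt0 !ffact_gt0 le1.
by rewrite e; apply/eqP; ring.
Qed.
End PermCount.

(** * Inclusion of subsets and finite differences *)

Local Open Scope ring_scope.

Section Inclusion.
Variable X : finType.
Implicit Types (B S U : {set X}).

Lemma exists_subset_card U k :
  (k <= #|U|)%N -> exists2 B : {set X}, B \subset U & #|B| = k.
Proof.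
move=> kU; have : (0 < #|[set B : {set X} | B \subset U & #|B| == k]|)%N.
  by rewrite cards_draws bin_gt0.
by case/card_gt0P => B; rewrite inE => /andP[BU /eqP cB]; exists B.
Qed.

(** Splits the subsets of [x |: B] according to whether they contain [x]. *)
Lemma sum_subsetsU1 (V : nmodType) (c : {set X} -> V) B x l : x \notin B ->
  \sum_(S : {set X} | (S \subset x |: B) && (#|S| == l.+1)) c S
  = \sum_(S : {set X} | (S \subset B) && (#|S| == l.+1)) c S
    + \sum_(S : {set X} | (S \subset B) && (#|S| == l)) c (x |: S).
Proof.
move=> xB; rewrite (bigID (fun S : {set X} => x \in S)) /= addrC; congr (_ + _).
  apply: eq_bigl => S; rewrite andbAC; congr (_ && _).
  apply/andP/idP => [[SxB xS]|SB].
    apply/subsetP => y yS; have := subsetP SxB y yS.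
    by rewrite !inE => /predU1P[yx|//]; rewrite -yx yS in xS.
  by rewrite (subset_trans SB (subsetU1 _ _)) (contra (subsetP SB x)).
rewrite (reindex_onto (fun S => x |: S) (fun S => S :\ x)) /=; last first.
  by move=> S /andP[_ xS]; rewrite setD1K.
apply: eq_bigl => S; rewrite setU11 andbT.
have [xS|xS] := boolP (x \in S).
  have -> : (x |: S) :\ x == S = false.
    by apply/negbTE/eqP => /setP/(_ x); rewrite !inE eqxx xS.
  by rewrite andbF; apply/esym/negbTE; rewrite negb_and (contraNN _ xB) // =>
    /subsetP->.
rewrite setU1K // eqxx andbT cardsU1 xS add1n eqSS; congr (_ && _).
rewrite subUset sub1set setU11 /=; apply/idP/idP => [SxB|SB].
  apply/subsetP => y yS; have := subsetP SxB y yS.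
  by rewrite !inE => /predU1P[yx|//]; rewrite yx (negbTE xS) in yS.
exact: subset_trans SB (subsetU1 _ _).
Qed.

(** One exchange of a point of [S] outside [S1] against one of [S1] outside [S] brings
[S] closer to [S1]. *)
Lemma swap_invariant_const (T : Type) (c : {set X} -> T) U l :
    (forall x y S, x \in U -> y \in U -> x != y -> S \subset U :\ x :\ y ->
       #|S| = l -> c (x |: S) = c (y |: S)) ->
  forall S S1, S \subset U -> S1 \subset U -> #|S| = l.+1 -> #|S1| = l.+1 ->
  c S = c S1.
Proof.
move=> swap S S1 SU S1U cS cS1.
elim: {S}#|S :\: S1| {-2}S (leqnn #|S :\: S1|) SU cS => [|d IH] S.
  rewrite leqn0 cards_eq0 setD_eq0 => SS1 _ cS.
  by congr c; apply/eqP; rewrite eqEcard SS1 cS cS1 /=.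
have [/eqP|] := eqVneq (S :\: S1) set0.
  rewrite setD_eq0 => SS1 _ _ cS.
  by congr c; apply/eqP; rewrite eqEcard SS1 cS cS1 /=.
case/set0Pn => x; rewrite inE => /andP[xS1 xS] dS SU cS.
have : S1 :\: S != set0.
  rewrite setD_eq0; apply/negP => S1S.
  have /eqP e : S1 == S by rewrite eqEcard S1S cS cS1 /=.
  by rewrite e xS in xS1.
case/set0Pn => y; rewrite inE => /andP[yS yS1].
have xy : x != y by apply: contraNneq yS => <-.
have cSx : #|S :\ x| = l by move: (cardsD1 x S); rewrite xS cS => -[].
have ySx : y \notin S :\ x by rewrite !inE negb_and yS orbT.
rewrite -(setD1K xS) (swap x y (S :\ x)) ?(subsetP SU x) ?(subsetP S1U y) //;
  last first.
  by apply/subsetD1P; rewrite setSD.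
apply: IH; last by rewrite cardsU1 ySx cSx.
  have : (#|(y |: S :\ x) :\: S1| < #|S :\: S1|)%N; last by lia.
  apply/proper_card/properP; split; last first.
    by exists x; rewrite !inE ?xS1 // (negbTE xy) eqxx.
  apply/subsetP => z; rewrite !inE => /andP[zS1 /predU1P[zy|/andP[_ ->]]].
    by rewrite zy yS1 in zS1.
  by rewrite zS1.
rewrite subUset sub1set (subsetP S1U y) //=.
exact: subset_trans (subsetDl _ _) SU.
Qed.

(** Gottlieb's theorem on the rank of the inclusion matrix. Comparing the hypothesis
for [x |: B] and [y |: B] shows that [c (x |: S) - c (y |: S)] satisfies it on [U]
without [x] and [y], for [l] and [k] diminished by one. By induction [c] does not
change when a point is exchanged, so it is constant, and therefore 0. *)
Lemma inclusion_sums_injective (R : numDomainType) l k U (c : {set X} -> R) :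
    (l <= k)%N -> (k + l <= #|U|)%N ->
    (forall B, B \subset U -> #|B| = k ->
       \sum_(S : {set X} | (S \subset B) && (#|S| == l)) c S = 0) ->
  forall S, S \subset U -> #|S| = l -> c S = 0.
Proof.
elim: l k U c => [|l IH] k U c lk kU sum0 S SU cS.
  have [B BU cB] := exists_subset_card (leq_trans (leq_addr 0 k) kU).
  have := sum0 B BU cB; rewrite (big_pred1 set0) => [|S']; last first.
    by rewrite cards_eq0 /=; case: eqP => [->|]; rewrite ?sub0set ?andbF.
  by have /eqP -> : S == set0 by rewrite -cards_eq0 cS.
case: k lk kU sum0 => // k lk kU sum0.
have swap x y S' : x \in U -> y \in U -> x != y -> S' \subset U :\ x :\ y ->
   #|S'| = l -> c (x |: S') = c (y |: S').
  move=> xU yU xy S'U cS'; apply/eqP; rewrite -subr_eq0; apply/eqP.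
  pose c' S := c (x |: S) - c (y |: S).
  apply: (IH k (U :\ x :\ y) c') S'U cS' => //.
    by have := cardsD1 x U; have := cardsD1 y (U :\ x);
      rewrite xU !inE eq_sym xy yU; lia.
  move=> B BU cB; rewrite sumrB; apply/eqP; rewrite subr_eq0; apply/eqP.
  have [yB xB BU'] : [/\ y \notin B, x \notin B & B \subset U].
    by case/subsetD1P: BU => /subsetD1P[].
  apply: (addrI (\sum_(S : {set X} | (S \subset B) && (#|S| == l.+1)) c S)).
  rewrite -!sum_subsetsU1 // !sum0 ?subUset ?sub1set ?xU ?yU //.
    by rewrite cardsU1 yB cB.
  by rewrite cardsU1 xB cB.
have cst := swap_invariant_const swap.
have [B BU cB] := exists_subset_card (leq_trans (leq_addr l.+1 k.+1) kU).
have := sum0 B BU cB.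
rewrite (eq_bigr (fun=> c S)) => [|S1 /andP[S1B /eqP cS1]]; last first.
  by apply: cst => //; apply: subset_trans BU.
rewrite sumr_const -cardsE cards_draws cB => /eqP; rewrite mulrn_eq0.
by rewrite -leqn0 leqNgt bin_gt0 lk /= => /eqP.
Qed.
End Inclusion.

Fixpoint forward_diff (i : nat) (h : nat -> int) (t : nat) : int :=
  if i is i'.+1 then forward_diff i' h t.+1 - forward_diff i' h t else h t.

(** Newton's interpolation formula. *)
Lemma newton_forward_diff (h : nat -> int) (t s : nat) :
  h (s + t)%N = \sum_(i < t.+1) forward_diff i h s *+ 'C(t, i).
Proof.
elim: t s => [|t IH] s; first by rewrite big_ord1 addn0.
rewrite addnS -addSn IH.
rewrite (eq_bigr (fun i : 'I_t.+1 =>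
    forward_diff i.+1 h s *+ 'C(t, i) + forward_diff i h s *+ 'C(t, i)));
      last first.
  by move=> i _; rewrite -mulrnDl /= subrK.
rewrite big_split /= [in RHS]big_ord_recl /= bin0.
rewrite [in RHS](eq_bigr (fun i : 'I_t.+1 =>
    forward_diff i.+1 h s *+ 'C(t, i.+1) + forward_diff i.+1 h s *+ 'C(t, i)));
      last first.
  by move=> i _; rewrite binS mulrnDr.
rewrite big_split /= addrA addrC; congr (_ + _).
have := @big_ord_recr _ 0 +%R t.+1 (fun i => forward_diff i h s *+ 'C(t, i)).
by rewrite /= bin_small // mulr0n addr0 => <-; rewrite big_ord_recl /= bin0.
Qed.

Lemma forward_diffE (h : nat -> int) (l s : nat) :
  forward_diff l h s = \sum_(t < l.+1) (-1) ^+ (l - t) * h (s + t)%N *+ 'C(l, t).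
Proof.
elim: l s => [|l IH] s; first by rewrite big_ord1 /= addn0 expr0 mul1r.
rewrite [LHS]/= !IH [in RHS]big_ord_recl /= bin0 subn0.
rewrite [in RHS](eq_bigr (fun t : 'I_l.+1 =>
    (-1) ^+ (l - t) * h (s.+1 + t)%N *+ 'C(l, t.+1)
    + (-1) ^+ (l - t) * h (s.+1 + t)%N *+ 'C(l, t))); last first.
  by move=> t _; rewrite binS mulrnDr addSnnS subSS.
rewrite big_split /= addrA addrC; congr (_ + _).
have := @big_ord_recr _ 0 +%R l.+1
  (fun t => (-1) ^+ (l.+1 - t) * h (s + t)%N *+ 'C(l, t)).
rewrite /= bin_small // mulr0n addr0 big_ord_recl /= bin0.
under [in X in _ + X = _]eq_bigr do rewrite /bump /= add1n addnS -addSn subSS.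
move=> ->; rewrite -sumrN; apply: eq_bigr => t _.
rewrite subSn; last by rewrite -ltnS.
by rewrite exprS mulN1r mulNr mulNrn.
Qed.

Local Close Scope ring_scope.

(** * Orbits of a family of subsets *)

Local Open Scope ring_scope.

Section OrbitCount.
Variable X : finType.
Implicit Types (A B S P Q : {set X}) (F : {set {set X}}) (s : {perm X}).

Definition move s F : {set {set X}} := [set s @: (A : {set X}) | A in F].

Lemma moveM s1 s2 F : move (s1 * s2)%g F = move s2 (move s1 F).
Proof. by rewrite /move -imset_comp; apply: eq_imset => A; exact: imset_permM. Qed.

Lemma move1 F : move 1%g F = F.
Proof.
by rewrite /move -[RHS]imset_id; apply: eq_imset => A; exact: imset_perm1.
Qed.

Lemma moveK s F : move s^-1%g (move s F) = F.
Proof. by rewrite -moveM mulgV move1. Qed.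

Lemma moveKV s F : move s (move s^-1%g F) = F.
Proof. by rewrite -moveM mulVg move1. Qed.

Lemma mem_move s F A : (s @: A \in move s F) = (A \in F).
Proof. exact/mem_imset/imset_inj/perm_inj. Qed.

Lemma mem_moveV s F A : (A \in move s F) = (s^-1%g @: A \in F).
Proof. by rewrite -{1}(imset_permKV s A) mem_move. Qed.

Definition family_orbit F : {set {set {set X}}} := [set move s F | s : {perm X}].
Definition family_stab F : {set {perm X}} := [set s : {perm X} | move s F == F].

Lemma family_stab_gt0 F : (0 < #|family_stab F|)%N.
Proof. by apply/card_gt0P; exists 1%g; rewrite inE move1. Qed.

Lemma mem_family_orbit F s : move s F \in family_orbit F.
Proof. exact: imset_f. Qed.

(** The permutations that move [F] to a given member of its orbit form a coset of the
stabilizer. *)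
Lemma sum_orbit F (phi : {set {set X}} -> nat) :
  (\sum_(s : {perm X}) phi (move s F)
   = #|family_stab F| * \sum_(G in family_orbit F) phi G)%N.
Proof.
rewrite (partition_big_imset (fun s => move s F)) /= big_distrr /=.
apply: eq_bigr => _ /imsetP[s _ ->].
rewrite (eq_bigr (fun=> phi (move s F))) => [|s' /eqP-> //].
rewrite sum_nat_const; congr (_ * _)%N.
rewrite -(card_imset (family_stab F) (mulIg s)); apply: eq_card => s'.
rewrite -{2}[s'](mulgKV s) (mem_imset _ _ (mulIg s)) !inE moveM.
transitivity (move s' F == move s F); first by [].
apply/eqP/eqP => [->|e]; first by rewrite moveK.
by rewrite -[in RHS]e moveKV.
Qed.

Variable F0 : {set {set X}}.
Local Notation W := (family_orbit F0).

Definition superset_count S B : nat :=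
  (\sum_(F in W) \sum_(A in F) ((B \in F) && (S \subset A)))%N.

(** Up to the size of the stabilizer, a member of the orbit is a permutation [s]. Its
element [B] is then [s @: P], and its element containing [S] is [s @: Q], for
unique [P] and [Q] in [F0]. *)
Lemma superset_countE S B :
  (#|family_stab F0| * superset_count S B
   = \sum_(P in F0) \sum_(Q in F0) #|constrained_perms P Q B S|)%N.
Proof.
have memB s : ((B \in move s F0) = \sum_(P in F0) (s @: P == B) :> nat)%N.
  have sP P : (s @: P == B) = (P == s^-1%g @: B).
    by rewrite -[in RHS](inj_eq (imset_inj (@perm_inj _ s))) imset_permKV.
  rewrite mem_moveV; under eq_bigr do rewrite sP.
  have [BF|BF] := boolP (_ \in F0).
    rewrite (bigD1 _ BF) /= eqxx big1 ?addn0 // => P /andP[_ /negbTE->] //.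
  by rewrite big1 // => P PF; case: eqP => // PB; rewrite -PB PF in BF.
rewrite -(sum_orbit F0 (fun F => \sum_(A in F) ((B \in F) && (S \subset A)))%N).
transitivity (\sum_(s : {perm X}) \sum_(P in F0) \sum_(Q in F0)
    ((s @: P == B) && (S \subset s @: Q)))%N.
  apply: eq_bigr => s _.
  rewrite exchange_big big_imset /=; last first.
    by move=> A C _ _; apply/imset_inj/perm_inj.
  apply: eq_bigr => Q _; rewrite -mulnb memB big_distrl /=.
  by apply: eq_bigr => P _; rewrite mulnb.
rewrite exchange_big; apply: eq_bigr => P _; rewrite exchange_big.
apply: eq_bigr => Q _; rewrite -sum1_card [RHS]big_mkcond /=.
by apply: eq_bigr => s _; rewrite inE; case: (_ && _).
Qed.

Variable k : nat.
Hypothesis F0_card : forall A, A \in F0 -> #|A| = k.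

Lemma orbit_card F A : F \in W -> A \in F -> #|A| = k.
Proof.
by case/imsetP => s _ -> /imsetP[A' A'F ->]; rewrite card_imset_perm F0_card.
Qed.

(** The right side of [superset_countE] in terms of [l = #|S|] and [t = #|S :&: B|]. *)
Definition pair_sum l t : nat :=
  ((\sum_(P in F0) \sum_(Q in F0) #|P :&: Q| ^_ t * #|Q :\: P| ^_ (l - t))
   * ((k - t)`! * (#|X| - k - (l - t))`!))%N.

(** The value of [superset_count] at [S] and [B] when [#|S| = l] and
[#|S :&: B| = t]; the division is exact whenever such sets exist. *)
Definition superset_profile l t : nat := (pair_sum l t %/ #|family_stab F0|)%N.

Lemma pair_sumE S B : #|B| = k ->
  (#|family_stab F0| * superset_count S B)%N = pair_sum #|S| #|S :&: B|.
Proof.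
move=> cB; rewrite superset_countE /pair_sum big_distrl; apply: eq_bigr => P PF /=.
rewrite big_distrl; apply: eq_bigr => Q QF /=.
rewrite card_constrained_perms; last by rewrite F0_card.
by rewrite cB -cardsD.
Qed.

Lemma superset_countP S B : #|B| = k ->
  superset_count S B = superset_profile #|S| #|S :&: B|.
Proof.
by move=> cB; rewrite /superset_profile -pair_sumE // mulKn ?family_stab_gt0.
Qed.

Lemma superset_profileE l t : (t <= k)%N -> (l - t <= #|X| - k)%N -> (t <= l)%N ->
  (k <= #|X|)%N -> (#|family_stab F0| * superset_profile l t)%N = pair_sum l t.
Proof.
move=> tk ltk tl kX.
have [B _ cB] : exists2 B : {set X}, B \subset setT & #|B| = k.
  by apply: exists_subset_card; rewrite cardsT.
have [S1 S1B cS1] : exists2 S : {set X}, S \subset B & #|S| = t.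
  by apply: exists_subset_card; rewrite cB.
have [S2 S2B cS2] : exists2 S : {set X}, S \subset ~: B & #|S| = (l - t)%N.
  by apply: exists_subset_card; have := cardsC B; rewrite cB; lia.
have S2BE : S2 :&: B = set0 by apply/eqP; rewrite setI_eq0 disjoints_subset.
have cSB : #|(S1 :|: S2) :&: B| = t.
  by rewrite setIUl S2BE setU0 (setIidPl S1B).
have cS : #|S1 :|: S2| = l.
  rewrite cardsU cS1 cS2 (_ : S1 :&: S2 = set0) ?cards0; last first.
    by apply/eqP; rewrite -subset0 -S2BE [S2 :&: B]setIC setSI.
  by rewrite subn0 subnKC.
by have := pair_sumE (S1 :|: S2) cB; rewrite superset_countP // cS cSB.
Qed.

End OrbitCount.

Local Close Scope ring_scope.

(** * The spectrum of the intersection matrix of an orbit *)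

Local Open Scope ring_scope.

Section Spectrum.
Variables (X : finType) (k : nat) (F0 : {set {set X}}).
Hypothesis F0_card : forall A, A \in F0 -> #|A| = k.
Hypothesis k_small : (2 * k <= #|X|)%N.
Implicit Types (A B S : {set X}) (F : {set {set X}}) (l m : nat).
Local Notation W := (family_orbit F0).

Definition level l : {set {set X}} := [set A : {set X} | #|A| == l].

Definition intersection_mx (R : nzRingType) (V : {set {set {set X}}}) :
    'M[R]_#|V| :=
  \matrix_(a < #|V|, b < #|V|) #|enum_val a :&: enum_val b|%:R.

Definition incidence_mx (R : nzRingType) : 'M[R]_(#|W|, #|level k|) :=
  \matrix_(i < #|W|, j < #|level k|)
    ((enum_val j : {set X}) \in (enum_val i : {set {set X}}))%:R.

(** The entry at [A], [B] is the number of members of the orbit that contain both. *)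
Definition gram_mx (R : nzRingType) : 'M[R]_#|level k| :=
  (incidence_mx R)^T *m incidence_mx R.

Definition inclusion_mx (R : nzRingType) l m : 'M[R]_(#|level l|, #|level m|) :=
  \matrix_(i < #|level l|, j < #|level m|)
    ((enum_val i : {set X}) \subset (enum_val j : {set X}))%:R.

Lemma level_card l (i : 'I_#|level l|) : #|enum_val i| = l.
Proof. by have := enum_valP i; rewrite inE => /eqP. Qed.

Lemma sum_level (V : nmodType) (l : nat) (f : {set X} -> V) :
  \sum_(j < #|level l|) f (enum_val j) = \sum_(B : {set X} | #|B| == l) f B.
Proof. by rewrite -big_enum_val /=; apply: eq_bigl => B; rewrite inE. Qed.

Lemma incidence_mulmx_tr (R : nzRingType) :
  incidence_mx R *m (incidence_mx R)^T = intersection_mx R W.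
Proof.
apply/matrixP => a b; rewrite !mxE.
under eq_bigr do rewrite !mxE -natrM mulnb.
rewrite -natr_sum (sum_level _ (fun A => nat_of_bool ((A \in enum_val a) && (A
  \in enum_val b)))).
congr (GRing.natmul _ _); rewrite -[RHS]sum1_card big_mkcond [RHS]big_mkcond.
  apply: eq_bigr => A _.
rewrite inE; case: ifP => [_|/negbT cA]; first by case: (_ && _).
case: ifP => // /andP[Aa _]; case/negP: cA; apply/eqP.
exact: (orbit_card F0_card (enum_valP a)).
Qed.

Lemma inclusion_mul_gram (R : comNzRingType) l :
  inclusion_mx R l k *m gram_mx R
  = \matrix_(i, j) (superset_count F0 (enum_val i) (enum_val j))%:R.
Proof.
apply/matrixP => i j; rewrite mulmxA !mxE.
under eq_bigr => F _.
  rewrite !mxE mulr_suml.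
  under eq_bigr do rewrite !mxE -!natrM !mulnb -andbA andbC -andbA.
  rewrite -natr_sum.
  rewrite (sum_level _ (fun A => nat_of_bool ((A \in enum_val F) && ((enum_val j
    \in enum_val F) && (enum_val i \subset A))))).
  over.
rewrite -natr_sum -(big_enum_val (fun F => \sum_(A : {set X} | #|A| == k) ((A \in
  F) && ((enum_val j \in F) && (enum_val i \subset A)) : nat)))%N.
congr (_ *+ _); apply: eq_bigr => F FW.
rewrite big_mkcond [RHS]big_mkcond; apply: eq_bigr => A _.
have [AF|] /= := boolP (A \in F); last by case: ifP.
by rewrite (orbit_card F0_card FW AF) eqxx.
Qed.

(** The leading coefficient in the Newton expansion of [superset_profile F0 k l] as a
function of [t]: the scalar by which the Gram matrix acts on degree [l] modulo
lower degrees. *)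
Definition theta l : int := forward_diff l (fun t => (superset_profile F0 k l
  t)%:Z) 0.

(** Both sides count the [i]-subsets that the two sets have in common. *)
Lemma inclusion_mul_inclusion (R : nzRingType) l i (a : 'I_#|level l|) (b :
  'I_#|level k|) :
  ((inclusion_mx R i l)^T *m inclusion_mx R i k) a b = 'C(#|enum_val a :&:
    enum_val b|, i)%:R.
Proof.
rewrite !mxE; under eq_bigr do rewrite !mxE -natrM mulnb -subsetI.
rewrite -natr_sum (sum_level _ (fun A => nat_of_bool (A \subset _))).
rewrite -cards_draws -sum1_card big_mkcond [in RHS]big_mkcond; congr (_ *+ _).
by apply: eq_bigr => A _; rewrite inE andbC; case: (_ == _); case: (_ \subset _).
Qed.

(** An entry on the left depends only on the size [t] of an intersection. Its Newton
expansion is in terms of ['C(t, i)], and each of these is a product of inclusion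
matrices. *)
Lemma inclusion_gram_triangular (R : comNzRingType) l :
  inclusion_mx R l k *m gram_mx R
  = \sum_(i < l.+1) (forward_diff i (fun t => (superset_profile F0 k l t)%:Z) 0)%:~R
       *: ((inclusion_mx R i l)^T *m inclusion_mx R i k).
Proof.
rewrite inclusion_mul_gram; apply/matrixP => a b; rewrite mxE summxE.
rewrite (superset_countP F0_card) ?level_card //.
set t := #|_ :&: _|.
have tl : (t <= l)%N by rewrite -[l in (_ <= l)%N](level_card a) subset_leq_card
  ?subsetIl.
under eq_bigr do rewrite mxE inclusion_mul_inclusion.
have := newton_forward_diff (fun t => (superset_profile F0 k l t)%:Z) t 0;
  rewrite add0n.
move=> /(congr1 (fun z : int => z%:~R : R)); rewrite /= -pmulrn => ->.
rewrite (big_ord_widen l.+1 (fun i => forward_diff i (fun t => (superset_profile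
  F0 k l t)%:Z) 0 *+ 'C(t, i))) //.
rewrite big_mkcond /= rmorph_sum; apply: eq_bigr => i _.
case: ifP => [_|/negbT it]; first by rewrite rmorphMn mulr_natr.
by rewrite bin_small ?mulr0 // ltnNge.
Qed.

Lemma inclusion_mx_id (R : nzRingType) l : inclusion_mx R l l = 1%:M.
Proof.
apply/matrixP => i j; rewrite !mxE -(inj_eq enum_val_inj) eqEcard !level_card
  leqnn andbT.
by [].
Qed.

Lemma inclusion_gram_theta (R : comNzRingType) l :
  inclusion_mx R l k *m (gram_mx R - (theta l)%:~R%:M)
  = \sum_(i < l) (forward_diff i (fun t => (superset_profile F0 k l t)%:Z) 0)%:~R
       *: ((inclusion_mx R i l)^T *m inclusion_mx R i k).
Proof.
rewrite mulmxBr inclusion_gram_triangular big_ord_recr /= inclusion_mx_id.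
by rewrite trmx1 mul1mx mul_mx_scalar addrK.
Qed.

(** The functions on [k]-subsets that are polynomials of degree less than [l] in the
indicators of the points. The shift of [l] makes the filtration start at 0. *)
Definition degree_space (R : fieldType) l : 'M[R]_#|level k| :=
  if l is l'.+1 then <<inclusion_mx R l' k>>%MS else 0.

Lemma card_between l A B : A \subset B -> #|A| = l ->
  #|[set S : {set X} | [&& #|S| == l.+1, A \subset S & S \subset B]]| = (#|B| -
    l)%N.
Proof.
move=> AB cA; have -> : (#|B| - l)%N = #|B :\: A| by rewrite cardsD (setIidPr AB)
  cA.
have inj : {in B :\: A &, injective (fun x => x |: A)}.
  move=> x y; rewrite !inE => /andP[xA _] /andP[yA _] /setP/(_ x).
  by rewrite !inE eqxx (negbTE xA) !orbF => /esym/eqP.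
rewrite -(card_in_imset inj); apply: eq_card => S; rewrite inE.
apply/and3P/imsetP => [[/eqP cS AS SB]|[x]].
  have : S :\: A != set0.
    by rewrite setD_eq0; apply/negP => /subset_leq_card; rewrite cS cA ltnn.
  case/set0Pn => x; rewrite inE => /andP[xA xS]; exists x.
    by rewrite inE xA (subsetP SB).
  apply/esym/eqP; rewrite eqEcard subUset sub1set xS AS cardsU1 xA cA cS add1n.
  by rewrite leqnn.
rewrite inE => /andP[xA xB] ->; split; first by rewrite cardsU1 xA cA.
  exact: subsetUr.
by rewrite subUset sub1set xB.
Qed.

Lemma inclusion_mul_next (R : nzRingType) l :
  inclusion_mx R l l.+1 *m inclusion_mx R l.+1 k = (k - l)%:R *: inclusion_mx R l k.
Proof.
apply/matrixP => i j; rewrite !mxE.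
under eq_bigr do rewrite !mxE -natrM mulnb.
rewrite -natr_sum (sum_level _ (fun A => nat_of_bool ((_ \subset A) && (A \subset
  _)))).
rewrite -natrM; congr (_ *+ _).
have [ij|ij] := boolP (enum_val i \subset enum_val j).
  rewrite muln1 -[k in RHS](level_card j) -(card_between ij (level_card i)).
  rewrite -[RHS]sum1_card big_mkcond [RHS]big_mkcond; apply: eq_bigr => S _.
  by rewrite inE; case: (#|S| == l.+1) => //=; case: (_ && _).
rewrite /= muln0 big1 // => S _; case: andP => // -[iS /(subset_trans iS)].
by rewrite (negbTE ij).
Qed.

Lemma degree_space_mono (R : numFieldType) l :
  (l <= k)%N -> (degree_space R l <= degree_space R l.+1)%MS.
Proof.
case: l => [|l] lk; first exact: sub0mx.
rewrite /= !genmxE -(@eqmx_scale _ _ _ (k - l)%:R) ?pnatr_eq0 ?subn_eq0 -?ltnNge //.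
by rewrite -inclusion_mul_next submxMl.
Qed.

Lemma degree_space_le (R : numFieldType) l m :
  (l <= m)%N -> (m <= k.+1)%N -> (degree_space R l <= degree_space R m)%MS.
Proof.
move=> /subnK <-; elim: (m - l)%N => [|d IH]; first by [].
by rewrite addSn => dk; apply: submx_trans (IH (ltnW dk)) (degree_space_mono _ _).
Qed.

Lemma degree_space_triangular (R : numFieldType) l : (l <= k)%N ->
  (degree_space R l.+1 *m (gram_mx R - (theta l)%:~R%:M) <= degree_space R l)%MS.
Proof.
move=> lk; rewrite /= (eqmxMr _ (genmxE _)) inclusion_gram_theta.
apply: summx_sub => i _; apply: scalemx_sub; apply: submx_trans (submxMl _ _) _.
apply: submx_trans (degree_space_le R (ltn_ord i) (leqW lk)).
by rewrite /= genmxE.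
Qed.

Lemma degree_space_full (R : fieldType) : row_full (degree_space R k.+1).
Proof. by rewrite /row_full /= genmxE inclusion_mx_id mxrank1. Qed.

Lemma rank_degree_space (R : numFieldType) l : (l <= k)%N ->
  \rank (degree_space R l.+1) = 'C(#|X|, l).
Proof.
move=> lk; rewrite /= genmxE.
suff /eqP -> : row_free (inclusion_mx R l k) by rewrite card_draws.
apply: inj_row_free => v /matrixP v0.
pose c S : R := \sum_(i | enum_val i == S) v 0 i.
have c0 S : S \subset setT -> #|S| = l -> c S = 0.
  move: S; apply: (@inclusion_sums_injective _ _ l k) => //.
    by rewrite cardsT; lia.
  move=> B _ /eqP cB.
  have Bk : B \in level k by rewrite inE.
  have := v0 0 (enum_rank_in Bk B); rewrite !mxE => v0B.
  rewrite -[RHS]v0B /c (exchange_big_dep predT) //=; apply: eq_bigr => i _.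
  rewrite mxE enum_rankK_in //.
  have [iB|iB] := boolP (enum_val i \subset B).
    rewrite mulr1 (big_pred1 (enum_val i)) // => S /=.
    by apply/andP/eqP => [[_ /eqP]//|->]; rewrite iB level_card !eqxx.
  rewrite mulr0 big_pred0 // => S; apply/negbTE/negP => /andP[/andP[SB _] /eqP e].
  by rewrite e SB in iB.
apply/rowP => i; rewrite mxE; have := c0 (enum_val i) (subsetT _) (level_card i).
rewrite /c (big_pred1 i) // => j /=; exact: (inj_eq enum_val_inj).
Qed.

Lemma gram_mx_sym (R : comNzRingType) : (gram_mx R)^T = gram_mx R.
Proof. by rewrite /gram_mx trmx_mul trmxK. Qed.

Lemma map_gram_mx (R : numFieldType) :
  map_mx (ratr : rat -> R) (gram_mx rat) = gram_mx R.
Proof.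
rewrite /gram_mx map_mxM -map_trmx.
suff -> : map_mx (ratr : rat -> R) (incidence_mx rat) = incidence_mx R by [].
by apply/matrixP => i j; rewrite !mxE ratr_nat.
Qed.

(** The dimension of the space of degree at most [l] modulo degree less than [l]. *)
Definition layer_dim l : nat := if l is l'.+1 then ('C(#|X|, l) - 'C(#|X|, l'))%N
  else 1%N.

Lemma rank_eigenspace_intersection (R : numFieldType) (a : R) : a != 0 ->
  \rank (eigenspace (intersection_mx R W) a)
  = (\sum_(l < k.+1 | (theta l)%:~R == a) layer_dim l)%N.
Proof.
move=> a0; rewrite -incidence_mulmx_tr (rank_eigenspace_mulmxC _ _ a0).
rewrite -/(gram_mx R) -map_gram_mx.
rewrite (@rank_eigenspace_filtration _ _ ratr _ k _ (degree_space rat) (fun l =>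
  (theta l)%:~R)) //.
- apply: eq_big => [l|l _]; first by rewrite /= ratr_int.
  case: l => -[|l] lk; rewrite !rank_degree_space //;
    first by rewrite /= mxrank0 subn0 bin0.
  by rewrite ltnW.
- exact: gram_mx_sym.
- exact: degree_space_mono.
- exact: degree_space_triangular.
- exact: degree_space_full.
Qed.
End Spectrum.

Local Close Scope ring_scope.

(** * Polytabloids *)

Local Open Scope ring_scope.

Section Polytabloid.
Variables (X : finType) (k : nat) (F0 : {set {set X}}).
Hypothesis F0_card : forall A, A \in F0 -> #|A| = k.
Hypothesis k_small : (2 * k <= #|X|)%N.
Variables (l : nat) (z : 'I_l -> bool -> X).
Hypothesis l_le : (l <= k)%N.
Hypothesis z_inj : forall i j b c, z i b = z j c -> i = j /\ b = c.
Implicit Types (A B S R : {set X}) (F : {set {set X}}).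
Local Notation W := (family_orbit F0).
Local Notation gram := (gram_mx k F0 rat).

(** The polytabloid of the pairs [(z i false, z i true)], as a function on subsets. It
is a vector of pure degree [l], so an eigenvector for [theta k F0 l], whose image
under the incidence matrix can be computed by hand. *)
Definition polytabloid B : rat :=
  \prod_(i < l) ((z i false \in B)%:R - (z i true \in B)%:R).

Lemma polytabloid_norm B : `|polytabloid B| <= 1.
Proof.
rewrite normr_prod; apply: prodr_ile1 => i _; rewrite normr_ge0 /=.
by case: (_ \in B); case: (_ \in B); rewrite ?subrr ?subr0 ?sub0r ?normrN ?normr0
  ?normr1.
Qed.

Lemma polytabloid1 B : (forall i, z i false \in B) -> (forall i, z i true \notin
  B) ->
  polytabloid B = 1.
Proof.
by move=> zB zNB; rewrite /polytabloid big1 // => i _;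
  rewrite zB (negbTE (zNB i)) subr0.
Qed.

Lemma polytabloid_swap i B : polytabloid (tperm (z i false) (z i true) @: B) = -
  polytabloid B.
Proof.
rewrite /polytabloid (bigD1 i) // [in RHS](bigD1 i) //= -mulNr opprB; congr (_ * _).
  by rewrite !mem_imset_perm tpermV tpermL tpermR.
apply: eq_bigr => j ji; rewrite !mem_imset_perm tpermV.
have zij b c : z i b != z j c.
  by apply/eqP => /z_inj[ij _]; rewrite ij eqxx in ji.
by rewrite !tpermD.
Qed.

Lemma missed_pair R : (#|R| < l)%N -> exists i, forall b, z i b \notin R.
Proof.
move=> Rl.
have [/existsP[i /forallP zi]|/existsPn noi] :=
  boolP [exists i, [forall b, z i b \notin R]]; first by exists i.
pose c i := if z i false \in R then z i false else z i true.
have cR i : c i \in R.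
  rewrite /c; case: ifP => // /negbT i0.
  by have /forallPn[[] /negPn] := noi i => //; rewrite (negbTE i0).
have c_inj : injective c.
  by move=> i j; rewrite /c; case: ifP; case: ifP => _ _ /z_inj[].
suff : (l <= #|R|)%N by rewrite leqNgt Rl.
rewrite -[l in (l <= _)%N]card_ord -(card_imset _ c_inj);
  apply/subset_leq_card/subsetP => _ /imsetP[i _ ->].
exact: cR.
Qed.

(** A set with fewer than [l] points misses one of the pairs. Exchanging the two
points of that pair preserves the sets containing [R] and changes the sign. *)
Lemma polytabloid_orthogonal R : (#|R| < l)%N ->
  \sum_(B : {set X} | #|B| == k) (R \subset B)%:R * polytabloid B = 0.
Proof.
case/missed_pair => i iR; pose t := tperm (z i false) (z i true).
have tR : t @: R = R by apply: tperm_imset_id; rewrite !(negbTE (iR _)).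
have t_inj : injective (fun B => t @: B) by apply/imset_inj/perm_inj.
set s := \sum_(B | _) _; suff : s = - s by move/eqP;
  rewrite -addr_eq0 -mulr2n mulrn_eq0 => /eqP.
rewrite -sumrN [s](reindex_inj t_inj) /=; apply: eq_big => [B|B _].
  by rewrite card_imset_perm.
by rewrite polytabloid_swap -{1}tR subset_imset_perm mulrN.
Qed.

Definition polytabloid_row : 'rV[rat]_#|level X k| := \row_j polytabloid
  (enum_val j).

Lemma polytabloid_row_orthogonal : (polytabloid_row <= orthocomp (degree_space X
  k rat l))%MS.
Proof.
apply/sub_kermxP; suff orth l' : (l' < l)%N ->
    polytabloid_row *m (inclusion_mx X rat l' k)^T = 0.
  case: l orth => [|l'] orth; first by rewrite trmx0 mulmx0.
  rewrite /=; have /submxP[D ->] : (<<inclusion_mx X rat l' k>> <= inclusion_mx X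
    rat l' k)%MS.
    by rewrite genmxE.
  by rewrite trmx_mul mulmxA orth ?mul0mx.
move=> l'l; apply/rowP => i; rewrite !mxE.
have Rl : (#|enum_val i| < l)%N by rewrite level_card.
rewrite -[RHS](polytabloid_orthogonal Rl) -sum_level; apply: eq_bigr => j _.
by rewrite !mxE mulrC.
Qed.

(** A choice of one point in each pair. *)
Definition transversal (phi : {ffun 'I_l -> bool}) : {set X} :=
  [set z i (phi i) | i : 'I_l].

Lemma transversal_card phi : #|transversal phi| = l.
Proof. by rewrite card_imset ?card_ord // => i j /z_inj[]. Qed.

(** The expansion of the product, which shows that the degree is at most [l]. *)
Lemma polytabloid_transversal B :
  polytabloid B = \sum_(phi : {ffun 'I_l -> bool})
            (\prod_i (-1) ^+ phi i) * (transversal phi \subset B)%:R.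
Proof.
rewrite /polytabloid.
transitivity (\prod_(i < l) \sum_(b : bool) ((-1) ^+ b * (z i b \in B)%:R : rat)).
  by apply: eq_bigr => i _; rewrite big_bool /= expr0 expr1 mul1r mulN1r addrC.
rewrite bigA_distr_bigA; apply: eq_bigr => phi _; rewrite big_split; congr (_ * _).
have [sB|/subsetPn[_ /imsetP[i _ ->] iB]] := boolP (transversal phi \subset B).
  by rewrite big1 // => i _; rewrite (subsetP sB) ?imset_f.
by rewrite (bigD1 i) //= (negbTE iB) mul0r.
Qed.

Lemma polytabloid_row_degree : (polytabloid_row <= degree_space X k rat l.+1)%MS.
Proof.
rewrite /= genmxE.
have -> : polytabloid_row = \sum_(phi : {ffun 'I_l -> bool}) (\prod_i (-1) ^+ phi
  i) *:
   (\row_j (transversal phi \subset (enum_val j : {set X}))%:R).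
  apply/rowP => j; rewrite summxE mxE polytabloid_transversal.
  by apply: eq_bigr => phi _; rewrite !mxE.
apply: summx_sub => phi _; apply: scalemx_sub.
have Tl : transversal phi \in level X l by rewrite inE transversal_card.
have -> : \row_j (transversal phi \subset (enum_val j : {set X}))%:R
  = row (enum_rank_in Tl (transversal phi)) (inclusion_mx X rat l k).
  by apply/rowP => j; rewrite !mxE enum_rankK_in.
exact: row_sub.
Qed.

Lemma polytabloid_eigen : polytabloid_row *m gram = (theta k F0 l)%:~R *:
  polytabloid_row.
Proof.
apply/eigenspaceP.
have eig := @layer_eigen _ _ k gram (degree_space X k rat)
  (fun m => (theta k F0 m)%:~R) (gram_mx_sym _ _ _) erefl.
apply: submx_trans (eig _ _ l l_le).
- by rewrite sub_capmx polytabloid_row_degree polytabloid_row_orthogonal.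
- exact: degree_space_mono.
- exact: degree_space_triangular.
Qed.

Lemma polytabloid_sum B : #|B| = k ->
  \sum_(F in W | B \in F) \sum_(A in F) polytabloid A = (theta k F0 l)%:~R *
    polytabloid B.
Proof.
move=> cB; have Bk : B \in level X k by rewrite inE cB.
have /rowP/(_ (enum_rank_in Bk B)) := polytabloid_eigen.
rewrite mulmxA !mxE enum_rankK_in // => <-.
rewrite (big_enum_val_cond (fun F => B \in F) (fun F => \sum_(A in F) polytabloid
  A)).
rewrite big_mkcond; apply: eq_bigr => F _; rewrite !mxE enum_rankK_in //.
case: ifP => [BF|]; last by rewrite mulr0.
rewrite mulr1; under [RHS]eq_bigr do rewrite !mxE.
rewrite (sum_level k (fun A => polytabloid A * (A \in enum_val F)%:R)).
rewrite big_mkcond [RHS]big_mkcond; apply: eq_bigr => A _.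
have [AF|_] := ifP; last by rewrite mulr0 if_same.
by rewrite (orbit_card F0_card (enum_valP F) AF) eqxx mulr1.
Qed.

(** The hypothesis on the orbit says that the incidence matrix kills the polytabloid. *)
Lemma theta_eq0 B : #|B| = k -> polytabloid B = 1 ->
  (forall F, F \in W -> \sum_(A in F) polytabloid A = 0) -> theta k F0 l = 0.
Proof.
move=> cB B1 F_0; have := polytabloid_sum cB;
  rewrite B1 mulr1 big1 => [/esym/eqP|F /andP[FW _]].
  by rewrite intr_eq0 => /eqP.
exact: F_0.
Qed.

(** Evaluated where the polytabloid is 1, its eigenvalue is a sum of values of the
polytabloid. None exceeds 1, and with 1 for each of them the sum is the eigenvalue
of the constant function. *)
Lemma theta_le B : #|B| = k -> polytabloid B = 1 -> theta k F0 l <= theta k F0 0.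
Proof.
move=> cB B1; have := polytabloid_sum cB; rewrite B1 mulr1 -(ler_int rat) => <-.
have -> : (theta k F0 0)%:~R = \sum_(F in W | B \in F) \sum_(A in F) 1 :> rat.
  rewrite /theta /=; have := superset_countP F0_card set0 cB.
  rewrite set0I !cards0 => <-; rewrite -pmulrn natr_sum big_mkcondr.
  apply: eq_bigr => F _; rewrite natr_sum; case: ifP => BF.
    by apply: eq_bigr => A _; rewrite sub0set.
  by rewrite big1.
apply: ler_sum => F _; apply: ler_sum => A _.
exact: le_trans (ler_norm _) (polytabloid_norm _).
Qed.

(** The squared norm of the image of the polytabloid under the incidence matrix is
[theta k F0 l] times the squared norm of the polytabloid, and the hypothesis says
that one coordinate of the image is not 0. *)
Lemma theta_gt0 : \sum_(A in F0) polytabloid A != 0 -> 0 < theta k F0 l.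
Proof.
move=> nz.
have e : \sum_(F in W) (\sum_(A in F) polytabloid A) ^+ 2
   = (theta k F0 l)%:~R * \sum_(B : {set X} | #|B| == k) polytabloid B ^+ 2.
  rewrite mulr_sumr.
  rewrite (eq_bigr (fun B => \sum_(F in W | B \in F) \sum_(A in F) polytabloid A
    * polytabloid B)); last first.
    by move=> B /eqP cB; rewrite expr2 mulrA -polytabloid_sum // mulr_suml;
      apply: eq_bigr => F _; rewrite mulr_suml.
  rewrite (exchange_big_dep (fun F => F \in W)) /= => [|B F _ /andP[]//].
  apply: eq_bigr => F FW; rewrite expr2 mulr_sumr; apply: eq_big => [B|B _].
    rewrite FW /=; apply/idP/andP => [BF|[]//].
    by rewrite (orbit_card F0_card FW).
  by rewrite mulr_suml.
have : 0 < (theta k F0 l)%:~R * \sum_(B : {set X} | #|B| == k) polytabloid B ^+ 2.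
  rewrite -e (bigD1 F0) /=; last by rewrite -{1}[F0]move1 mem_family_orbit.
  by rewrite ltr_wpDr ?sumr_ge0 // => [F _|];
    rewrite ?sqr_ge0 // lt0r sqr_ge0 sqrf_eq0 nz.
have h : 0 <= \sum_(B : {set X} | #|B| == k) polytabloid B ^+ 2 by rewrite
  sumr_ge0 // => B _; rewrite sqr_ge0.
by rewrite -(ltr_int rat); nra.
Qed.
End Polytabloid.

Local Close Scope ring_scope.

(** * Families pulled back along equal fibres *)

Section Lift.
Variables (I X : finType) (g : nat).
Variables (at_ : X -> I) (co : X -> 'I_g) (mk : I -> 'I_g -> X).
Hypothesis at_mk : forall a c, at_ (mk a c) = a.
Hypothesis co_mk : forall a c, co (mk a c) = c.
Hypothesis mkK : forall x, mk (at_ x) (co x) = x.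
Hypothesis g_gt0 : 0 < g.
Implicit Types (A : {set I}) (G : {set {set I}}) (s : {perm X}) (t : {perm I}).

Let c0 : 'I_g := Ordinal g_gt0.

Definition lift_family G : {set {set X}} := [set at_ @^-1: A | A : {set I} in G].

Lemma preim_at_inj : injective (fun A => at_ @^-1: A).
Proof.
move=> A B /setP AB; apply/setP => a.
by have := AB (mk a c0); rewrite !inE at_mk.
Qed.

Lemma card_preim_at A : #|at_ @^-1: A| = #|A| * g.
Proof.
have inj : injective (fun u : I * 'I_g => mk u.1 u.2).
  move=> [a c] [b d] /= e; congr (_, _).
    by rewrite -(at_mk a c) e at_mk.
  by rewrite -(co_mk a c) e co_mk.
rewrite -[g in RHS]card_ord -cardsT -cardsX -(card_imset _ inj).
apply: eq_card => x; rewrite inE; apply/idP/imsetP => [xA|[[a c]]].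
  by exists (at_ x, co x); rewrite ?inE ?andbT //= mkK.
by rewrite !inE andbT => aA ->; rewrite at_mk.
Qed.

Lemma card_lift_family G : #|lift_family G| = #|G|.
Proof. exact/card_imset/preim_at_inj. Qed.

(** An element of the wreath product: [u.1] permutes the fibres, and [u.2 a] acts on
the fibre over [a] before it is moved. *)
Definition wreath_fun (u : {perm I} * {ffun I -> {perm 'I_g}}) (x : X) : X :=
  mk (u.1 (at_ x)) (u.2 (at_ x) (co x)).

Lemma wreath_fun_inj u : injective (wreath_fun u).
Proof.
move=> x y e; have /perm_inj xy : u.1 (at_ x) = u.1 (at_ y).
  by have := congr1 at_ e; rewrite !at_mk.
have := congr1 co e; rewrite !co_mk xy => /perm_inj cxy.
by rewrite -(mkK x) -(mkK y) xy cxy.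
Qed.

Definition wreath_perm u : {perm X} := perm (@wreath_fun_inj u).

Lemma wreath_perm_inj : injective wreath_perm.
Proof.
move=> [t r] [t' r'] /permP e.
have e1 a c : mk (t a) (r a c) = mk (t' a) (r' a c).
  by have := e (mk a c); rewrite !permE /wreath_fun /= !at_mk !co_mk.
congr (_, _); first by apply/permP => a; rewrite -(at_mk (t a) (r a c0)) e1 at_mk.
by apply/ffunP => a; apply/permP => c; rewrite -(co_mk (t a) (r a c)) e1 co_mk.
Qed.

Lemma move_wreath_perm u G :
  move (wreath_perm u) (lift_family G) = lift_family (move u.1 G).
Proof.
rewrite /move /lift_family -!imset_comp; apply: eq_imset => A /=.
apply/setP => x; have [y ->] : exists y, x = wreath_perm u y.
  by exists ((wreath_perm u)^-1%g x); rewrite permKV.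
rewrite mem_imset; last exact: perm_inj.
rewrite !inE permE /wreath_fun at_mk mem_imset //.
exact: perm_inj.
Qed.

Definition separates G := forall a b, a != b -> exists2 A, A \in G & (a \in A) &&
  (b \notin A).

(** Two points have the same image in [I] exactly when the same members of the family
contain both of them, and [s] permutes the members. *)
Lemma stab_preserves_fibres G s : separates G -> s \in family_stab (lift_family
  G) ->
  forall x y, at_ x = at_ y -> at_ (s x) = at_ (s y).
Proof.
move=> sepG; rewrite inE => /eqP sG x y xy; apply/eqP;
  apply: contraT => /sepG[A AG /andP[xA yA]].
have : at_ @^-1: A \in lift_family G by apply: imset_f.
rewrite -sG => /imsetP[_ /imsetP[B BG ->] /setP e].
have := e (s x); have := e (s y); rewrite !(mem_imset _ _ perm_inj) !inE xy.
by rewrite xA (negbTE yA) => <-.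
Qed.

Lemma stab_lift_wreath G s : separates G -> s \in family_stab (lift_family G) ->
  exists2 u, s = wreath_perm u & u.1 \in family_stab G.
Proof.
move=> sepG sS; have fib := stab_preserves_fibres sepG sS.
have sVS : s^-1%g \in family_stab (lift_family G).
  by move: sS; rewrite !inE => /eqP e; rewrite -{1}e moveK.
have fibV := stab_preserves_fibres sepG sVS.
have t_inj : injective (fun a => at_ (s (mk a c0))).
  by move=> a b /fibV; rewrite !permK !at_mk.
have r_inj a : injective (fun c => co (s (mk a c))).
  move=> c d e; have : s (mk a c) = s (mk a d).
    by rewrite -[LHS]mkK -[RHS]mkK e; congr mk; apply: fib; rewrite !at_mk.
  by move/perm_inj => e2; rewrite -(co_mk a c) e2 co_mk.
pose u := (perm t_inj, [ffun a => perm (r_inj a)]).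
have su : s = wreath_perm u.
  apply/permP => x; rewrite permE /wreath_fun /= ffunE !permE mkK -[LHS]mkK.
  by congr mk; apply: fib; rewrite at_mk.
exists u => //; move: sS; rewrite !inE su move_wreath_perm.
by rewrite (inj_eq (imset_inj preim_at_inj)).
Qed.

(** The stabilizer is the wreath product of the symmetric group of a fibre by the
stabilizer of [G]. *)
Lemma card_stab_lift G : separates G ->
  #|family_stab (lift_family G)| = #|family_stab G| * g`! ^ #|I|.
Proof.
move=> sepG; have -> : family_stab (lift_family G)
    = wreath_perm @: setX (family_stab G) setT.
  apply/setP => s; apply/idP/imsetP => [/(stab_lift_wreath sepG)[[t r] -> uG]|[[t
    r]]].
    by exists (t, r); rewrite // in_setX uG in_setT.
  rewrite in_setX in_setT andbT !inE => uG ->; rewrite move_wreath_perm.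
  by rewrite (inj_eq (imset_inj preim_at_inj)).
rewrite (card_imset _ wreath_perm_inj) cardsX cardsT card_ffun.
congr (_ * _ ^ _).
have <- : #|perm_on [set: 'I_g]| = g`! by rewrite card_perm cardsT card_ord.
by apply: eq_card => s; rewrite !inE; apply/esym/subsetP => x; rewrite inE.
Qed.
End Lift.

(** * Windows of a cycle *)

Lemma val_Zp_sub p (a b : 'I_p.+2) :
  nat_of_ord (a - b)%R = (if (b <= a)%N then a - b else a + p.+2 - b)%N.
Proof.
have am := ltn_ord a; have bm := ltn_ord b; rewrite /= modnDmr.
case: leqP => ba; last by rewrite modn_small //; lia.
by rewrite (_ : a + (p.+2 - b) = (a - b) + p.+2)%N ?modnDr ?modn_small; lia.
Qed.

Section Windows.
Variables (p q : nat).
Local Notation m := p.+2.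
Hypothesis q_gt0 : 0 < q.
Hypothesis qm : 2 * q < m.
Local Open Scope ring_scope.
Implicit Types (a b c : 'I_m).

Definition window c : {set 'I_m} := [set a : 'I_m | (nat_of_ord (a - c)%R < q)%N].
Definition windows : {set {set 'I_m}} := [set window c | c : 'I_m].

Lemma mem_window a c :
  (a \in window c) = (if c <= a then a - c < q else a + m - c < q)%N.
Proof. by rewrite inE val_Zp_sub; case: ifP. Qed.

Lemma card_window c : #|window c| = q.
Proof.
have -> : window c = (fun a => a + c) @: [set a : 'I_m | (a < q)%N].
  apply/setP => a; rewrite inE; apply/idP/imsetP => [ac|[b]].
    by exists (a - c); rewrite ?inE ?subrK.
  by rewrite inE => bq ->; rewrite addrK.
rewrite card_imset; last exact: addIr.
have -> : [set a : 'I_m | (a < q)%N] = (fun i : 'I_q => inord i) @: 'I_q.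
  apply/setP => a; rewrite inE; apply/idP/imsetP => [aq|[i _ ->]].
    by exists (Ordinal aq); rewrite //= inord_val.
  by rewrite inordK //; have := ltn_ord i; lia.
rewrite card_imset ?card_ord // => i j /(congr1 val) /=.
by rewrite !inordK => [/val_inj//||]; [have := ltn_ord j|have := ltn_ord i]; lia.
Qed.

Lemma window_inj : injective window.
Proof.
move=> a b /setP e; apply/ord_inj; have := e a; have := e b;
  rewrite !mem_window !leqnn !subnn q_gt0 => e1 e2.
have am := ltn_ord a; have bm := ltn_ord b; move: e1 e2.
by case: (leqP a b) => ?; case: (leqP b a) => ? *; lia.
Qed.

Lemma card_windows : #|windows| = m.
Proof. by rewrite card_imset ?card_ord //; exact: window_inj. Qed.

Lemma card_windows_through a : (\sum_(A in windows) (a \in A) = q)%N.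
Proof.
rewrite big_imset /=; last by move=> ? ? _ _; exact: window_inj.
rewrite -(card_window 0) -sum1_card [RHS]big_mkcond.
rewrite (reindex_inj (h := fun c => a - c)); last by move=> ? ? /addrI/oppr_inj.
by apply: eq_bigr => c _; rewrite !inE opprB addrC subrK subr0; case: ifP.
Qed.

(** Either [window a], which starts at [a], misses [b], or [b] follows [a] by less than
[q] steps and the window that ends at [a] misses [b]. *)
Lemma windows_separate : separates windows.
Proof.
move=> a b ab; have [aq|aq] := boolP (b \in window a); last first.
  by exists (window a); rewrite ?imset_f // aq inE subrr q_gt0.
have am := ltn_ord a; have bm := ltn_ord b.
have ab' : a <> b :> nat by move/val_inj => e; rewrite e eqxx in ab.
pose c : 'I_m := inord ((a + m - q.-1) %% m).
exists (window c); rewrite ?imset_f //.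
have cE : nat_of_ord c = (if q.-1 <= a then a - q.-1 else a + m - q.-1)%N.
  rewrite inordK ?ltn_mod //; case: leqP => h; last by rewrite modn_small //; lia.
  by rewrite (_ : a + m - q.-1 = (a - q.-1) + m)%N ?modnDr ?modn_small; lia.
move: aq; rewrite !mem_window.
move: cE; case: (leqP q.-1 a) => ? ->; case: (leqP a b) => ?;
  by case: (leqP _ a) => ?; case: (leqP _ b) => ? /=; lia.
Qed.
End Windows.

(** * The symmetries of the windows *)

Lemma val_Zp_add1 p (a : 'I_p.+2) :
  nat_of_ord (a + 1)%R = (if a == p.+1 :> nat then 0 else a.+1)%N.
Proof.
have am := ltn_ord a; rewrite /= (modn_small (_ : 1 < p.+2)%N) //.
case: eqP => [->|]; first by rewrite /= addn1 modnn.
by move=> ?; rewrite modn_small addn1 //; lia.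
Qed.

Lemma val_Zp_sub1 p (a : 'I_p.+2) :
  nat_of_ord (a - 1)%R = (if a == 0%N :> nat then p.+1 else a.-1)%N.
Proof.
have am := ltn_ord a; rewrite (val_Zp_sub a) /= (modn_small (_ : 1 < p.+2)%N) //.
by case: leqP; case: eqP; lia.
Qed.

Lemma natr_Zp_neq0 p i : 0 < i < p.+2 -> (i%:R : 'I_p.+2)%R != 0%R.
Proof.
case/andP=> i0 im; apply/eqP => /(congr1 (@nat_of_ord p.+2)).
by rewrite (Zp_nat p) /= modn_small //; lia.
Qed.

Section WindowStab.
Variables (p q : nat).
Local Notation m := p.+2.
Hypothesis q_gt0 : 0 < q.
Hypothesis qm : 2 * q < m.
Local Open Scope ring_scope.
Implicit Types (a b c : 'I_m) (s : {perm 'I_m}).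

Definition adjacent a b := (b == a + 1) || (b == a - 1).

(** This condition is expressed in terms of the family of windows, so that it is
preserved by the stabilizer. *)
Definition once_separated a b :=
  forall A B, A \in windows p q -> B \in windows p q ->
    a \in A -> b \notin A -> a \in B -> b \notin B -> A = B.

(** If [b] is next to [a], the only window that contains [a] but not [b] is the one
that starts or ends at [a]. Otherwise there are two: with [a] at offset [q - 2] or
[q - 1] if [b] follows [a] at distance at most [m - q], and with [a] at offset 0 or
1 if the distance is larger. *)
Lemma adjacentP a b : (1 < q)%N -> a != b -> adjacent a b <-> once_separated a b.
Proof.
move=> q1 ab; have am := ltn_ord a; have bm := ltn_ord b.
have {}ab : a <> b :> nat by move/ord_inj => e; rewrite e eqxx in ab.
split=> [adj _ _ /imsetP[c _ ->] /imsetP[d _ ->]|once].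
  have cm := ltn_ord c; have dm := ltn_ord d.
  have adj_val : (b = (if a == p.+1 :> nat then 0 else a.+1)%N :> nat) \/
                 (b = (if a == 0%N :> nat then p.+1 else a.-1)%N :> nat).
    by case/orP: adj => /eqP ->; [left; rewrite val_Zp_add1|right;
      rewrite val_Zp_sub1].
  rewrite !mem_window => ac bc ad bd; congr window; apply/ord_inj.
  case: adj_val; case: eqP => ? ?; move: ac bc ad bd;
    case: (leqP c a) => ?; case: (leqP c b) => ?;
    case: (leqP d a) => ?; case: (leqP d b) => ?; lia.
apply: contraT; rewrite negb_or => /andP[n1 n2].
have {}n1 : b <> (if a == p.+1 :> nat then 0 else a.+1)%N :> nat.
  by rewrite -val_Zp_add1 => /ord_inj e; rewrite e eqxx in n1.
have {}n2 : b <> (if a == 0%N :> nat then p.+1 else a.-1)%N :> nat.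
  by rewrite -val_Zp_sub1 => /ord_inj e; rewrite e eqxx in n2.
pose w o : 'I_m := a - inord o.
have wE o : (o < m)%N -> w o = (if o <= a then a - o else a + m - o)%N :> nat.
  by move=> om; rewrite val_Zp_sub inordK.
(* The window in which [a] has offset [o]. *)
have no o o' : (o < o')%N -> (o' < q)%N -> b \notin window q (w o) ->
    b \notin window q (w o') -> False.
  move=> oo' oq bo bo'.
  have aw u : (u < q)%N -> a \in window q (w u).
    by move=> uq; rewrite inE opprB addrC subrK inordK //; lia.
  have := once _ _ (imset_f _ _) (imset_f _ _) (aw o _) bo (aw o' _) bo'.
  have oq' := ltn_trans oo' oq.
  move=> /(_ isT isT oq' oq)/(window_inj q_gt0 qm) e.
  have : nat_of_ord (w o) = w o' by rewrite e.
  rewrite !wE; try lia.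
  by case: (leqP o a) => ?; case: (leqP o' a) => ?; lia.
pose d := (if a <= b then b - a else b + m - a)%N.
exfalso; have [dmq|dmq] := leqP d (m - q).
  apply: (no q.-2 q.-1); try lia; rewrite mem_window wE; try lia.
    move: dmq n1 n2; rewrite /d; case: eqP => ?; case: eqP => ?;
      case: (leqP a b) => ?;
    case: (leqP _ a) => ?; case: (leqP _ b) => ?; lia.
  move: dmq n1 n2; rewrite /d; case: eqP => ?; case: eqP => ?;
    case: (leqP a b) => ?;
  case: (leqP _ a) => ?; case: (leqP _ b) => ?; lia.
apply: (no 0%N 1%N); try lia; rewrite mem_window wE; try lia.
  move: dmq n1 n2; rewrite /d; case: eqP => ?; case: eqP => ?;
    case: (leqP a b) => ?;
  case: (leqP _ a) => ?; case: (leqP _ b) => ?; lia.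
move: dmq n1 n2; rewrite /d; case: eqP => ?; case: eqP => ?; case: (leqP a b) => ?;
case: (leqP _ a) => ?; case: (leqP _ b) => ?; lia.
Qed.

Lemma stab_adjacent s a b : (1 < q)%N -> s \in family_stab (windows p q) ->
  adjacent a b -> adjacent (s a) (s b).
Proof.
move=> q1; rewrite inE => /eqP sW adj.
have ab : a != b.
  apply/eqP => e; move: adj; rewrite /adjacent -e => /orP[]/eqP/(congr1
    (@nat_of_ord m)).
    by rewrite val_Zp_add1; case: eqP; have := ltn_ord a; lia.
  by rewrite val_Zp_sub1; case: eqP; have := ltn_ord a; lia.
apply/adjacentP => //; first by rewrite (inj_eq perm_inj).
move=> A B; rewrite -sW => /imsetP[A' A'W ->] /imsetP[B' B'W ->].
rewrite !(mem_imset _ _ perm_inj) => aA bA aB bB.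
suff -> : A' = B' by [].
exact: ((adjacentP q1 ab).1 adj _ _ A'W B'W aA bA aB bB).
Qed.

Definition dihedral_fun (u : bool * 'I_m) a : 'I_m := u.2 + (if u.1 then - a else
  a).

Lemma dihedral_fun_inj u : injective (dihedral_fun u).
Proof. by case: u => -[] s a b /addrI // /oppr_inj. Qed.

Definition dihedral_perm u : {perm 'I_m} := perm (@dihedral_fun_inj u).

Lemma dihedral_perm_inj : injective dihedral_perm.
Proof.
move=> [e s] [e' s'] /permP h.
have ss : s = s' by have := h 0; rewrite !permE /dihedral_fun /= oppr0 !if_same
  !addr0.
have := h 1; rewrite !permE /dihedral_fun /= ss => /addrI.
have n2 : (2%:R : 'I_m) != 0 by apply: natr_Zp_neq0; lia.
case: e e' {h} => -[] // /eqP.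
  by rewrite eq_sym -addr_eq0 -(natrD _ 1 1) (negbTE n2).
by rewrite -addr_eq0 -(natrD _ 1 1) (negbTE n2).
Qed.

Lemma dihedral_stab u : dihedral_perm u \in family_stab (windows p q).
Proof.
have sub : move (dihedral_perm u) (windows p q) \subset windows p q.
  apply/subsetP => _ /imsetP[_ /imsetP[c _ ->] ->].
  pose c' := u.2 + (if u.1 then - c - inord q.-1 else c).
  suff -> : dihedral_perm u @: window q c = window q c' by apply: imset_f.
  apply/setP => y; have [x ->] : exists x, y = dihedral_perm u x.
    by exists ((dihedral_perm u)^-1%g y); rewrite permKV.
  rewrite (mem_imset _ _ perm_inj) permE /dihedral_fun /c' !inE.
  case: u.1; rewrite opprD addrACA subrr add0r ?opprK //.
  have -> : - x - (- c - inord q.-1) = inord q.-1 - (x - c) :> 'I_m.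
    by rewrite !opprD !opprK addrA addrC addrA.
  rewrite (val_Zp_sub (inord q.-1)) inordK; last by lia.
  by have := ltn_ord (x - c); case: (leqP (nat_of_ord (x - c)) q.-1) => ? ?; lia.
rewrite inE eqEcard sub [X in (_ <= X)%N]card_imset ?leqnn //.
exact/imset_inj/perm_inj.
Qed.

(** The image of a walk around the cycle makes unit steps. It never turns around,
since that would visit a point twice. *)
Lemma stab_dihedral s : (1 < q)%N -> s \in family_stab (windows p q) ->
  exists u, s = dihedral_perm u.
Proof.
move=> q1 sW; have n2 : (2%:R : 'I_m) != 0 by apply: natr_Zp_neq0; lia.
have step i : adjacent (s i%:R) (s i.+1%:R).
  by apply: stab_adjacent => //; rewrite /adjacent -natr1 eqxx.
have [e se] : exists e : bool, s 1 = s 0 + (if e then - 1 else 1).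
  by case/orP: (step 0%N) => /eqP; [exists false|exists true].
exists (e, s 0); apply/permP => a; rewrite permE /dihedral_fun /= -(natr_Zp a).
suff H i : s i%:R = s 0 + (if e then - i%:R else i%:R)
    /\ s i.+1%:R = s 0 + (if e then - i.+1%:R else i.+1%:R) by case: (H a).
elim: i => [|i [IH0 IH1]]; first by rewrite oppr0 if_same addr0.
split=> //; have far : s i.+2%:R != s i%:R.
  have -> : i.+2%:R = 2%:R + i%:R :> 'I_m by rewrite -natrD.
  by rewrite (inj_eq perm_inj) -subr_eq0 addrK.
move: far; case/orP: (step i.+1) => /eqP ->; rewrite IH0 IH1; case: (e).
- by rewrite -!natr1 opprD -!addrA addNr addr0 eqxx.
- by rewrite -addrA natr1.
- by rewrite -addrA -opprD natr1.
- by rewrite -!natr1 -!addrA subrr addr0 eqxx.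
Qed.

Lemma card_window_stab : (1 < q)%N -> #|family_stab (windows p q)| = (2 * m)%N.
Proof.
move=> q1; have -> : family_stab (windows p q) = dihedral_perm @: setT.
  apply/setP => s; apply/idP/imsetP => [/(stab_dihedral q1)[u ->]|[u _ ->]].
    by exists u.
  exact: dihedral_stab.
by rewrite (card_imset _ dihedral_perm_inj) cardsT card_prod card_bool card_ord.
Qed.
End WindowStab.

Lemma card_window1_stab p : #|family_stab (windows p 1)| = p.+2`!.
Proof.
have w1 (c : 'I_p.+2) : window 1 c = [set c].
  by apply/setP => a; rewrite !inE -[RHS]subr_eq0 -val_eqE ltnS leqn0.
rewrite -[p.+2 in RHS]card_ord -cardsT -card_perm; apply: eq_card => s.
rewrite inE; transitivity true.
  rewrite eqEcard [X in (_ <= X)%N]card_imset; last exact/imset_inj/perm_inj.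
  rewrite leqnn andbT; apply/subsetP => _ /imsetP[_ /imsetP[c _ ->] ->].
  by rewrite w1 imset_set1 -w1 imset_f.
by apply/esym/subsetP => x; rewrite inE.
Qed.

(** * Eigenvalues for the wreath family *)

(** Provides pairs for a polytabloid equal to 1 at [A], the first two of which are
prescribed. *)
Lemma exists_separated_pairs (X : finType) (A : {set X}) l (x0 x1 y0 y1 : X) :
    x0 \in A -> x1 \in A -> x0 != x1 -> y0 \notin A -> y1 \notin A -> y0 != y1 ->
    l.+2 <= #|A| -> l.+2 <= #|~: A| ->
  exists z : 'I_l.+2 -> bool -> X,
    [/\ forall i j b c, z i b = z j c -> i = j /\ b = c,
        forall i b, (z i b \in A) = ~~ b,
        z (inord 0) false = x0, z (inord 1) false = x1
      & z (inord 0) true = y0 /\ z (inord 1) true = y1].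
Proof.
have aux (B : {set X}) u v : u \in B -> v \in B -> u != v -> l.+2 <= #|B| ->
    exists2 f : 'I_l.+2 -> X, injective f & (forall i, f i \in B)
       /\ f (inord 0) = u /\ f (inord 1) = v.
  move=> uB vB uv lB; pose r := u :: v :: enum (B :\ u :\ v).
  have r_uniq : uniq r.
    by rewrite /= enum_uniq andbT inE !mem_enum !inE !eqxx /= negb_or uv andbF.
  have r_size : size r = #|B|.
    rewrite /= -cardE; have := cardsD1 u B; have := cardsD1 v (B :\ u).
    by rewrite uB !inE eq_sym uv vB; lia.
  have rB w : w \in r -> w \in B.
    by rewrite !inE mem_enum !inE => /or3P[/eqP->|/eqP->|/and3P[]].
  have ir (i : 'I_l.+2) : i < size r by rewrite r_size; apply: leq_trans lB.
  exists (fun i => nth u r i).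
    by move=> i j /eqP; rewrite nth_uniq // => /eqP/ord_inj.
  by split=> [i|]; [apply/rB/mem_nth|rewrite !inordK].
move=> x0A x1A x01 y0A y1A y01 lA lAc.
have [f f_inj [fA [f0 f1]]] := aux A x0 x1 x0A x1A x01 lA.
have [h h_inj [hA [h0 h1]]] : exists2 f : 'I_l.+2 -> X, injective f
     & (forall i, f i \in ~: A) /\ f (inord 0) = y0 /\ f (inord 1) = y1.
  by apply: aux; rewrite ?inE.
exists (fun i b => if b then h i else f i); split=> //.
- move=> i j [] [] e.
  + by rewrite (h_inj _ _ e).
  + by have := hA i; rewrite inE e fA.
  + by have := hA j; rewrite inE -e fA.
  + by rewrite (f_inj _ _ e).
- by move=> i [] /=; rewrite ?fA //; have := hA i; rewrite inE => /negbTE.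
Qed.

Section WreathModel.
Variables (X : finType) (p q g : nat).
Local Notation m := p.+2.
Local Notation n := (m * g).
Local Notation k := (q * g).
Variables (at_ : X -> 'I_m) (co : X -> 'I_g) (mk : 'I_m -> 'I_g -> X).
Hypothesis at_mk : forall a c, at_ (mk a c) = a.
Hypothesis co_mk : forall a c, co (mk a c) = c.
Hypothesis mkK : forall x, mk (at_ x) (co x) = x.
Hypothesis g_gt0 : 0 < g.
Hypothesis q_gt0 : 0 < q.
Hypothesis qm : 2 * q < m.

Let c0 : 'I_g := Ordinal g_gt0.
Definition base_family : {set {set X}} := lift_family at_ (windows p q).
Local Notation F0 := base_family.
Local Notation W := (family_orbit F0).
Local Notation block a := (at_ @^-1: window q a).

Lemma card_model : #|X| = n.
Proof.
by rewrite -cardsT -(preimsetT at_) (card_preim_at at_mk co_mk mkK) cardsT card_ord.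
Qed.

Lemma mem_base A : A \in F0 -> exists c : 'I_m, A = block c.
Proof. by case/imsetP => _ /imsetP[c _ ->] ->; exists c. Qed.

Lemma block_base (c : 'I_m) : block c \in F0.
Proof. by apply/imset_f/imset_f. Qed.

Lemma base_card A : A \in F0 -> #|A| = k.
Proof.
by case/mem_base => c ->; rewrite (card_preim_at at_mk co_mk mkK) card_window.
Qed.

Lemma model_small : 2 * k <= #|X|.
Proof. by rewrite card_model mulnA leq_mul2r (ltnW qm) orbT. Qed.

Lemma card_base : #|F0| = m.
Proof. by rewrite (card_lift_family at_mk g_gt0) card_windows. Qed.

Lemma sum_base (V : nmodType) (f : {set X} -> V) :
  (\sum_(A in F0) f A = \sum_(c : 'I_m) f (block c))%R.
Proof.
rewrite big_imset /=; last by move=> ? ? _ _; apply: (preim_at_inj at_mk g_gt0).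
by rewrite big_imset //= => ? ? _ _; apply: window_inj.
Qed.

Lemma base_regular x : (\sum_(A in F0) (x \in A) = q)%N.
Proof.
rewrite (sum_base (fun A => nat_of_bool (x \in A))).
rewrite -[RHS](card_windows_through q_gt0 qm (at_ x)) big_imset /=; last first.
  by move=> ? ? _ _; apply: window_inj.
by apply: eq_bigr => c _; rewrite inE.
Qed.

Lemma orbit_regular F x : F \in W -> (\sum_(A in F) (x \in A) = q)%N.
Proof.
case/imsetP => s _ ->; rewrite big_imset /=; last first.
  by move=> ? ? _ _; apply/imset_inj/perm_inj.
rewrite -(base_regular (s^-1%g x)); apply: eq_bigr => A _.
by rewrite mem_imset_perm.
Qed.

(** By regularity the incidence matrix kills the difference of two indicators. *)
Lemma model_theta1 : theta k F0 1 = 0%R.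
Proof.
pose y := mk (inord q) c0; pose x := mk 0%R c0.
pose z (i : 'I_1) (b : bool) := if b then y else x.
have B0 := base_card (block_base 0%R).
have xB : x \in block 0%R by rewrite inE at_mk mem_window.
have yB : y \notin block 0%R.
  by rewrite inE at_mk mem_window leq0n subn0 inordK ?ltnn //; lia.
apply: (@theta_eq0 _ _ _ base_card 1 z _ _ (block 0%R)) => //.
- by rewrite muln_gt0 q_gt0.
- move=> i j b c; rewrite !ord1 /z => zbc; split=> //; move: zbc.
  have xy : x != y by apply: contraTneq xB => ->.
  by case: b c => -[] // /eqP; rewrite ?(negbTE xy) // eq_sym (negbTE xy).
- by apply: polytabloid1.
- move=> F FW; rewrite /polytabloid; under eq_bigr do rewrite big_ord1 /z.
  by rewrite sumrB -!natr_sum !orbit_regular ?subrr.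
Qed.

Lemma model_theta0 :
  (#|family_stab F0| * superset_profile F0 k 0 0 = m ^ 2 * (k`! * (n - k)`!))%N.
Proof.
have kn : k <= n by rewrite leq_mul2r; apply/orP; right; lia.
rewrite (superset_profileE base_card) ?card_model //.
rewrite /pair_sum card_model !subn0; congr (_ * _)%N.
under eq_bigr => P _ do under eq_bigr do rewrite !ffactn0.
by rewrite !sum_nat_const card_base !muln1 mulnn.
Qed.

Lemma model_theta0_gt0 : (0 < theta k F0 0)%R.
Proof.
rewrite /theta /= ltz_nat -(ltn_pmul2l (family_stab_gt0 F0)) muln0 model_theta0.
by rewrite !muln_gt0 !fact_gt0.
Qed.

(** The sets of the first halves of the pairs lie in the block of index 0, so that
this block contributes 1. Two pairs are chosen to make all other blocks contribute
0: [x0] and [x1] in the first and the last atom of the block, [y0] in the atom just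
before and [y1] in the atom just after the block. As [2 * q < m], every other block
avoids both [x0] and [y0], or both [x1] and [y1]. *)
Lemma model_theta_gt0 l : 2 <= l <= k -> (0 < theta k F0 l <= theta k F0 0)%R.
Proof.
case: l => [|[|l]] // lk; have {}lk : l.+2 <= k by [].
have g1 : g.-1 < g by rewrite prednK.
pose x0 := mk 0%R c0; pose x1 := mk (inord q.-1) (Ordinal g1).
pose y0 := mk (inord p.+1) c0; pose y1 := mk (inord q) c0.
have blockE (a c : 'I_m) d : (mk a d \in block c) = (if c <= a then a - c < q
  else a + m - c < q).
  by rewrite inE at_mk mem_window.
have vq : nat_of_ord (inord q : 'I_m) = q by rewrite inordK //; lia.
have vq1 : nat_of_ord (inord q.-1 : 'I_m) = q.-1 by rewrite inordK //; lia.
have vp : nat_of_ord (inord p.+1 : 'I_m) = p.+1 by rewrite inordK.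
have v0 : nat_of_ord (0%R : 'I_m) = 0 by [].
have qm' : q.-1 < m by lia.
have [z [z_inj zA [z00 z10] [z01 z11]]] :
    exists z : 'I_l.+2 -> bool -> X,
    [/\ forall i j b c, z i b = z j c -> i = j /\ b = c,
        forall i b, (z i b \in block 0%R) = ~~ b,
        z (inord 0) false = x0, z (inord 1) false = x1
      & z (inord 0) true = y0 /\ z (inord 1) true = y1].
  have klt : k <= #|~: block 0%R|.
    have := cardsC (block 0%R); rewrite card_model (base_card (block_base 0%R)).
    have : 2 * k <= m * g by rewrite -card_model model_small.
    lia.
  apply: exists_separated_pairs.
  - by rewrite blockE.
  - by rewrite blockE v0 leq0n vq1; lia.
  - apply/eqP => e; have := congr1 at_ e; have := congr1 co e.
    rewrite !co_mk !at_mk => /(congr1 val) /= e1 /(congr1 (@nat_of_ord m)).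
    rewrite vq1 v0 => e2; have : q = 1 by lia.
    by move=> q1; rewrite q1 in lk; lia.
  - by rewrite blockE v0 leq0n vp; lia.
  - by rewrite blockE v0 leq0n vq; lia.
  - apply/eqP => e; have := congr1 at_ e.
    by rewrite !at_mk => /(congr1 (@nat_of_ord m)); rewrite vp vq; lia.
  - by rewrite (base_card (block_base 0%R)).
  - exact: leq_trans klt.
have B0 := base_card (block_base 0%R).
have tab0 : polytabloid z (block 0%R) = 1%R by apply: polytabloid1 => i; rewrite zA.
rewrite (theta_le base_card lk z_inj B0 tab0) andbT.
apply: (theta_gt0 base_card lk z_inj).
rewrite sum_base (bigD1 0%R) //= tab0 big1 ?addr0 ?oner_eq0 // => c c_neq0.
have cm := ltn_ord c.
have {}c_neq0 : c != 0 :> nat by [].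
(* It is enough to find a pair of which the block misses both points. *)
have zero i : z i false \notin block c -> z i true \notin block c -> polytabloid
  z (block c) = 0%R.
  by move=> z0 z1; rewrite /polytabloid (bigD1 i) //= (negbTE z0) (negbTE z1)
    subrr mul0r.
have [cq|cq] := eqVneq (c : nat) q.
  apply: (zero (inord 0)); rewrite ?z00 ?z01 !blockE ?vp ?v0.
    by case: (leqP (nat_of_ord c) _) => ?; lia.
  by case: (leqP (nat_of_ord c) _) => ?; lia.
have [cmq|cmq] := leqP c (m - q).
  have [cq'|cq'] := ltnP c q.
    apply: (zero (inord 0)); rewrite ?z00 ?z01 !blockE ?vp ?v0.
      by case: (leqP (nat_of_ord c) _) => ?; lia.
    by case: (leqP (nat_of_ord c) _) => ?; lia.
  apply: (zero (inord 1)); rewrite ?z10 ?z11 !blockE ?vq1 ?vq.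
    by case: (leqP (nat_of_ord c) _) => ?; lia.
  by case: (leqP (nat_of_ord c) _) => ?; lia.
apply: (zero (inord 1)); rewrite ?z10 ?z11 !blockE ?vq1 ?vq.
  by case: (leqP (nat_of_ord c) _) => ?; lia.
by case: (leqP (nat_of_ord c) _) => ?; lia.
Qed.
End WreathModel.

(** * The eigenvalue zero *)

Section ZeroEigenvalue.
Variables (X : finType) (k : nat) (F0 : {set {set X}}) (S : {set X}).
Hypothesis F0_card : forall A, A \in F0 -> #|A| = k.
Local Open Scope ring_scope.
Local Notation W := (family_orbit F0).
Hypothesis S_stab : forall s, perm_on S s -> s \in family_stab F0 -> s = 1%g.
Hypothesis S3 : (2 < #|S|)%N.

(** Pigeonhole among three points. *)
Lemma same_side (A : {set X}) :
  exists x y, [/\ x \in S, y \in S, x != y & (x \in A) = (y \in A)].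
Proof.
have [h|h] := ltnP 1 #|S :&: A|.
  have [x [y [xS yS xy]]] := card_gt1P h.
  move: xS yS; rewrite !inE => /andP[xS xA] /andP[yS yA].
  by exists x, y; rewrite xA yA.
have [|x [y [xS yS xy]]] := @card_gt1P _ (S :\: A) _.
  by rewrite cardsD; lia.
move: xS yS; rewrite !inE => /andP[/negbTE xA xS] /andP[/negbTE yA yS].
by exists x, y; rewrite xA yA.
Qed.

(** The alternating sum of the images of [F0] under the permutations of [S]. *)
Definition alternating_row (R : numFieldType) : 'rV[R]_#|W| :=
  \row_i \sum_(s | perm_on S s) (-1) ^+ odd_perm s * (move s F0 == enum_val i)%:R.

Lemma alternating_row_neq0 (R : numFieldType) : alternating_row R != 0.
Proof.
have F0W : F0 \in W by rewrite -{1}[F0]move1 mem_family_orbit.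
apply/eqP => /rowP/(_ (enum_rank_in F0W F0)); rewrite !mxE enum_rankK_in //.
rewrite (bigD1 1%g) /=; last by apply/subsetP => x; rewrite inE perm1 eqxx.
rewrite move1 eqxx odd_perm1 expr0 mulr1 big1 => [|s /andP[sS s1]].
  by rewrite addr0 => /eqP; rewrite oner_eq0.
case: eqP => [sF|]; last by rewrite mulr0.
by rewrite (S_stab sS) ?eqxx // inE sF in s1.
Qed.

(** If [x] and [y] are on the same side of [A], the terms for [s] and [s * tperm x y]
cancel. *)
Lemma alternating_sum0 (R : numFieldType) A :
  \sum_(s | perm_on S s) (-1) ^+ odd_perm s * (A \in move s F0)%:R = 0 :> R.
Proof.
have [x [y [xS yS xy xyA]]] := same_side A; pose t := tperm x y.
have tA : t @: A = A by apply: tperm_imset_id.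
have tS : perm_on S t.
  by apply/subsetP => z; rewrite inE; case: tpermP => [->|->|]; rewrite ?eqxx.
have tSE s : perm_on S (s * t)%g = perm_on S s.
  apply/idP/idP => [sS|sS]; last exact: perm_onM.
  by rewrite -[s](mulgK t); apply: perm_onM; rewrite ?tpermV.
set e := LHS; suff : e = - e by move/eqP;
  rewrite -addr_eq0 -mulr2n mulrn_eq0 => /eqP.
rewrite -sumrN /e (reindex_inj (mulIg t)) /=; apply: eq_big => [s|s _];
  first exact: tSE.
rewrite odd_permM odd_tperm xy addbT moveM -{1}tA mem_move.
by rewrite -mulNr; case: (odd_perm s); rewrite /= ?expr0 ?expr1 ?opprK.
Qed.

Lemma alternating_row_kernel (R : numFieldType) :
  alternating_row R *m intersection_mx R W = 0.
Proof.
rewrite -(incidence_mulmx_tr F0_card) mulmxA.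
suff -> : alternating_row R *m incidence_mx k F0 R = 0 by rewrite mul0mx.
apply/rowP => j; rewrite !mxE; under eq_bigr do rewrite !mxE mulr_suml.
rewrite exchange_big /= -[RHS](alternating_sum0 R (enum_val j));
  apply: eq_bigr => s _.
have sW := mem_family_orbit F0 s.
rewrite (bigD1 (enum_rank_in sW (move s F0))) //= enum_rankK_in // eqxx mulr1.
rewrite big1 ?addr0 // => i i_ne; case: eqP => [e|]; last by rewrite mulr0 mul0r.
case/eqP: i_ne; apply: enum_val_inj; rewrite enum_rankK_in //.
Qed.

Lemma eigenvalue0 (R : numFieldType) : eigenvalue (intersection_mx R W) 0.
Proof.
apply/eigenvalueP; exists (alternating_row R); last exact: alternating_row_neq0.
by rewrite alternating_row_kernel scale0r.
Qed.
End ZeroEigenvalue.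

(** * Overlaps of windows *)

(** A subset of [k.+1] points with [t + u + 1] elements is determined by its element of
rank [t], at position [j], with [t] elements before and [u] after it. *)
Lemma sum_bin_bin k t u :
  \sum_(j < k.+1) 'C(j, t) * 'C(k - j, u) = 'C(k.+1, (t + u).+1).
Proof.
elim: k u => [|k IH] u.
  by rewrite big_ord1 subnn; case: t => [|t]; case: u => [|u];
    rewrite ?muln0 ?mul0n // bin_small.
case: u => [|u].
  rewrite addn0 big_ord_recr /= subnn !bin0 muln1 binS addnC.
  have := IH 0; rewrite addn0 => <-.
  by rewrite addnC; congr (_ + _); apply: eq_bigr => j _; rewrite !bin0.
rewrite big_ord_recr /= subnn muln0 addn0 addnS binS -(IH u) -addnS -(IH u.+1).
rewrite -big_split /=; apply: eq_bigr => j _.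
rewrite subSn; last by rewrite -ltnS.
by rewrite binS mulnDr.
Qed.

Lemma card_ord_interval m lo hi : hi <= m ->
  #|[set y : 'I_m | lo <= y < hi]| = hi - lo.
Proof.
case: m => [|m] him.
  by rewrite (_ : hi = 0) ?sub0n; last lia; apply/eqP;
    rewrite -leqn0 (leq_trans (max_card _)) ?card_ord.
have -> : [set y : 'I_m.+1 | lo <= y < hi] = (fun i : 'I_(hi - lo) => inord (lo +
  i)) @: 'I_(hi - lo).
  apply/setP => y; rewrite inE; apply/idP/imsetP => [yI|[i _ ->]].
    have ylt : y - lo < hi - lo by lia.
    exists (Ordinal ylt) => //; apply/ord_inj; rewrite /= subnKC; last by lia.
    by rewrite inord_val.
  by have iI := ltn_ord i; rewrite inordK; lia.
rewrite card_imset ?card_ord // => i j /(congr1 (@nat_of_ord m.+1)).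
have iI := ltn_ord i; have jI := ltn_ord j.
by rewrite !inordK; [move=> /addnI/ord_inj|lia|lia].
Qed.

Section Overlaps.
Variables (p q : nat).
Local Notation m := p.+2.
Hypothesis q_gt0 : 0 < q.
Hypothesis qm : 2 * q < m.
Implicit Types (a c : 'I_m).

(** The number of common points of two windows at distance [s] around the cycle. *)
Definition overlap (s : nat) := if s <= q then q - s else q - (m - s).

Lemma card_window_overlap a c :
  #|window q a :&: window q c| = overlap (c - a)%R.
Proof.
pose s : 'I_m := (c - a)%R; have sm := ltn_ord s; rewrite -/s.
pose lo := if s <= q then nat_of_ord s else 0.
pose hi := if s <= q then q else q - (m - s).
have -> : window q a :&: window q c
    = (fun y => y + a)%R @: [set y : 'I_m | lo <= y < hi].
  apply/setP => x; transitivity ((x - a)%R \in [set y : 'I_m | lo <= y < hi]).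
    have xc : (x - c = (x - a) - s)%R by rewrite /s opprB addrA subrK.
    rewrite !inE xc; move: (x - a)%R => y; have ym := ltn_ord y.
    rewrite val_Zp_sub /lo /hi.
    by case: (leqP s y) => ?; case: (leqP s q) => ?; lia.
  apply/idP/imsetP => [yI|[y yI ->]]; last by rewrite addrK.
  by exists (x - a)%R => //; rewrite subrK.
rewrite card_imset; last exact: addIr.
rewrite card_ord_interval; last by rewrite /hi; case: ifP; lia.
by rewrite /overlap /hi /lo; case: ifP => // _; rewrite subn0.
Qed.

(** Every overlap from 0 to [q] occurs on both sides of [window a]: [q] would be counted
twice, hence the additional term on the left, and the other windows are disjoint
from [window a]. *)
Lemma sum_overlaps a (G : nat -> nat) :
  \sum_(c : 'I_m) G #|window q a :&: window q c| + G q
  = 2 * (\sum_(j < q.+1) G j) + (m - 2 * q - 1) * G 0.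
Proof.
rewrite (eq_bigr (fun c => G (overlap (c - a)%R))) => [|c _]; last first.
  by rewrite card_window_overlap.
have -> : \sum_(c : 'I_m) G (overlap (c - a)%R) = \sum_(c : 'I_m) G (overlap c).
  rewrite [RHS](reindex_inj (h := fun c => (c - a)%R)) //; exact: addIr.
have first : \sum_(0 <= s < q.+1) G (overlap s) = \sum_(j < q.+1) G j.
  rewrite big_mkord (reindex_inj rev_ord_inj) /=; apply: eq_bigr => j _.
  have jq := ltn_ord j; rewrite /overlap subSS leq_subr; congr G; lia.
have middle : \sum_(q.+1 <= s < m - q) G (overlap s) = (m - 2 * q - 1) * G 0.
  rewrite (eq_big_nat _ _ (F2 := fun=> G 0)) => [|s sI]; last first.
    by rewrite /overlap; case: (leqP s q) => ?; congr G; lia.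
  by rewrite sum_nat_const_nat; congr (_ * _); lia.
have last : \sum_(m - q <= s < m) G (overlap s) + G q = \sum_(j < q.+1) G j.
  rewrite -[m - q]add0n big_addn (_ : m - (m - q) = q); last by lia.
  rewrite big_ord_recr big_mkord /=; congr (_ + _); apply: eq_bigr => j _.
  have jq := ltn_ord j; rewrite /overlap; case: (leqP _ q) => ?; congr G; lia.
rewrite -(big_mkord xpredT (fun s => G (overlap s))).
rewrite (@big_cat_nat _ _ _ q.+1) //=; last by lia.
rewrite (@big_cat_nat _ _ _ (m - q) q.+1) /=; try lia.
rewrite first middle; move: last; set M := (m - 2 * q - 1) * G 0;
  set S := \sum_(j < q.+1) G j; set L := bigop _ _ _; lia.
Qed.
End Overlaps.

(** * The coprime case *)

Section CoprimeModel.
Variables (X : finType) (p q : nat).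
Local Notation m := p.+2.
Variables (at_ : X -> 'I_m) (co : X -> 'I_1) (mk : 'I_m -> 'I_1 -> X).
Hypothesis at_mk : forall a c, at_ (mk a c) = a.
Hypothesis co_mk : forall a c, co (mk a c) = c.
Hypothesis mkK : forall x, mk (at_ x) (co x) = x.
Hypothesis q_gt1 : 1 < q.
Hypothesis qm : 2 * q < m.
Local Notation F0 := (base_family q at_).
Let q_gt0 : 0 < q. Proof. exact: ltnW. Qed.

Lemma card_block1 (A : {set 'I_m}) : #|at_ @^-1: A| = #|A|.
Proof. by rewrite (card_preim_at at_mk co_mk mkK) muln1. Qed.

Lemma base_card1 A : A \in F0 -> #|A| = q.
Proof. by move=> AF; rewrite (base_card at_mk co_mk mkK q_gt0 qm AF) muln1. Qed.

Lemma card_stab1 : #|family_stab F0| = 2 * m.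
Proof.
rewrite (card_stab_lift at_mk co_mk mkK (ltn0Sn 0) (windows_separate q_gt0 qm)).
by rewrite card_window_stab // card_ord exp1n muln1.
Qed.

(** For each [Q] in the family, the part of [pair_sum] that depends on the overlap [j]
of [P] and [Q]. *)
Definition overlap_term l t j := j ^_ t * (q - j) ^_ (l - t).

Lemma coprime_profile l t : t <= l <= q ->
  2 * superset_profile F0 q l t + overlap_term l t q * ((q - t)`! * (m - q - (l -
    t))`!)
  = (2 * \sum_(j < q.+1) overlap_term l t j + (m - 2 * q - 1) * overlap_term l t 0)
    * ((q - t)`! * (m - q - (l - t))`!).
Proof.
case/andP=> tl lq; have cX := card_model at_mk co_mk mkK; rewrite muln1 in cX.
have : #|family_stab F0| * superset_profile F0 q l t = pair_sum F0 q l t.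
  by apply: superset_profileE; rewrite ?cX //; try lia; exact: base_card1.
rewrite card_stab1 /pair_sum cX; set f := (_`! * _).
have row (P : {set X}) : P \in F0 ->
    \sum_(Q in F0) #|P :&: Q| ^_ t * #|Q :\: P| ^_ (l - t) + overlap_term l t q
    = 2 * \sum_(j < q.+1) overlap_term l t j + (m - 2 * q - 1) * overlap_term l t 0.
  case/mem_base => a ->; rewrite -(sum_overlaps q_gt0 qm a); congr (_ + _).
  rewrite (sum_base at_mk (ltn0Sn 0) q_gt0 qm); apply: eq_bigr => c _.
  by rewrite -preimsetI -preimsetD !card_block1 /overlap_term cardsD card_window
    // setIC.
have tot : \sum_(P in F0) \sum_(Q in F0) #|P :&: Q| ^_ t * #|Q :\: P| ^_ (l - t)
      + m * overlap_term l t q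
    = m * (2 * \sum_(j < q.+1) overlap_term l t j + (m - 2 * q - 1) *
      overlap_term l t 0).
  have cF : #|F0| = m by apply: (card_base at_mk (ltn0Sn 0) q_gt0 qm).
  have cst K : m * K = \sum_(P in F0) K by rewrite sum_nat_const cF.
  rewrite !cst -big_split /=; apply: eq_bigr => P; exact: row.
set A := \sum_(P in F0) _ in tot *; move=> e.
apply/eqP; rewrite -(eqn_pmul2l (ltn0Sn p.+1)) mulnDr mulnA [m * 2]mulnC e.
by rewrite mulnA -mulnDl tot mulnA.
Qed.

(** This is why the main term of the eigenvalue has a common factor for all [t]. *)
Lemma sum_overlap_term l t : t <= l -> 'C(l, t) * \sum_(j < q.+1) overlap_term l
  t j = l`! * 'C(q.+1, l.+1).
Proof.
move=> tl; have := sum_bin_bin q t (l - t); rewrite subnKC // => <-.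
rewrite !big_distrr /=; apply: eq_bigr => j _.
by rewrite -(bin_fact tl) /overlap_term -!bin_ffact; ring.
Qed.

Local Open Scope ring_scope.

(** Stated for arbitrary numbers, since with the actual factorials and binomial
coefficients the casts would be pushed into them. *)
Lemma solve_profile (R : numFieldType) (H C SG K1 K2 Gq G0 f1 f2 M : nat) :
    (C * SG = K1 * K2)%N ->
    (2 * H + Gq * (f1 * f2) = (2 * SG + M * G0) * (f1 * f2))%N ->
  H%:R * C%:R = K1%:R * K2%:R * (f1%:R * f2%:R)
    + 1 / 2 * (M%:R * (G0 * (f1 * f2) * C)%:R - (Gq * (f1 * f2) * C)%:R) :> R.
Proof.
move=> e1 e2; rewrite -[K1%:R * _]natrM -e1 -[f1%:R * _]natrM.
move: (f1 * f2)%N e2 => f /(congr1 (fun i => i%:R : R)).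
rewrite !(natrM, natrD) => e2.
have -> : H%:R * C%:R = 1 / 2 * ((2 * H%:R + Gq%:R * f%:R) * C%:R - Gq%:R * f%:R
  * C%:R) :> R by field.
by rewrite e2; field.
Qed.

(** The two conditionals are the corrections for the disjoint pairs of blocks, which
only matter when [t = 0], and for equal blocks, which only matter when [t = l]. *)
Lemma coprime_term (R : numFieldType) l t : (t <= l <= q)%N ->
  (superset_profile F0 q l t)%:R * 'C(l, t)%:R
  = (l`!)%:R * 'C(q.+1, l.+1)%:R * (((q - t)`!)%:R * ((m - q - l + t)`!)%:R)
    + 1 / 2 * ((m%:R - 2 * q%:R - 1)
        * (if t == 0%N then (l`!)%:R * 'C(q, l)%:R * (q`!)%:R * ((m - q -
          l)`!)%:R else 0)
      - (if t == l then (q`!)%:R * ((m - q)`!)%:R else 0)) :> R.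
Proof.
move=> tlq; have /andP[tl lq] := tlq.
have qm' : m%:R - 2 * q%:R - 1 = (m - 2 * q - 1)%:R :> R.
  by rewrite natrB ?natrB ?natrM //; lia.
have -> : (if t == 0%N then (l`!)%:R * 'C(q, l)%:R * (q`!)%:R * ((m - q -
  l)`!)%:R else 0)
   = (overlap_term l t 0 * ((q - t)`! * (m - q - (l - t))`!) * 'C(l, t))%:R :> R.
  case: eqP => [->|/eqP]; last by case: t {tlq tl} => // t _;
    rewrite /overlap_term ffact0n !mul0n.
  rewrite /overlap_term !subn0 ffactn0 bin0 mul1n muln1 -bin_ffact !natrM; ring.
have -> : (if t == l then (q`!)%:R * ((m - q)`!)%:R else 0)
   = (overlap_term l t q * ((q - t)`! * (m - q - (l - t))`!) * 'C(l, t))%:R :> R.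
  case: eqP => [->|/eqP tl'].
    rewrite /overlap_term !subnn ffactn0 binn subn0 !muln1 mulnA -natrM.
    by rewrite ffact_fact.
  by rewrite /overlap_term subnn; case: (l - t)%N (subn_gt0 t l) => [|u _];
    rewrite ?ffact0n ?muln0 ?mul0n //; lia.
have -> : (m - q - l + t = m - q - (l - t))%N by lia.
rewrite qm'; exact: solve_profile (sum_overlap_term tl) (coprime_profile tlq).
Qed.

Lemma coprime_theta (R : numFieldType) l : (2 <= l <= q)%N ->
  (theta q F0 l)%:~R =
      (-1) ^+ l * (1 / 2) * (l`!)%:R * (q`!)%:R * ((m - q - l)`!)%:R
        * (m%:R - 2 * q%:R - 1) * 'C(q, l)%:R
      - (1 / 2) * (q`!)%:R * ((m - q)`!)%:R
      + (l`!)%:R * 'C(q.+1, l.+1)%:R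
        * \sum_(0 <= j < l.+1)
            (-1) ^+ (l - j) * ((q - j)`!)%:R * ((m - q - l + j)`!)%:R :> R.
Proof.
case/andP=> l2 lq.
have distr (s a b c h d x y : R) :
    s * (a * (b * c) + h * (d * x - y)) = a * (s * b * c) + (s * (h * d) * x - s
      * h * y).
  by ring.
rewrite /theta forward_diffE rmorph_sum big_mkord /=.
rewrite (eq_bigr (fun t : 'I_l.+1 =>
    (l`!)%:R * 'C(q.+1, l.+1)%:R * ((-1) ^+ (l - t) * ((q - t)`!)%:R * ((m - q -
      l + t)`!)%:R)
    + ((-1) ^+ (l - t) * (1 / 2 * (m%:R - 2 * q%:R - 1)) *
        (if t == 0%N :> nat then (l`!)%:R * 'C(q, l)%:R * (q`!)%:R * ((m - q -
          l)`!)%:R else 0)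
      - (-1) ^+ (l - t) * (1 / 2) * (if t == l :> nat then (q`!)%:R * ((m -
        q)`!)%:R else 0)))); last first.
  move=> t _; have tl : (t <= l <= q)%N by rewrite -ltnS ltn_ord.
  rewrite rmorphMn rmorphM rmorphXn rmorphN1 /= add0n -pmulrn -mulr_natr -mulrA.
  rewrite coprime_term //; exact: distr.
rewrite big_split /= -mulr_sumr addrC; congr (_ + _).
rewrite sumrB; congr (_ - _).
  rewrite big_ord_recl /= big1 ?addr0; last by move=> i _; rewrite mulr0.
  by rewrite subn0; ring.
rewrite big_ord_recr /= big1 ?add0r.
  by rewrite subnn eqxx expr0 mul1r mulrA.
by move=> i _; rewrite (ltn_eqF (ltn_ord i)) mulr0.
Qed.
End CoprimeModel.

(** * Three points with trivial stabilizer *)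

Section ThreePoints.
Variables (X : finType) (p q g : nat).
Local Notation m := p.+2.
Variables (at_ : X -> 'I_m) (co : X -> 'I_g) (mk : 'I_m -> 'I_g -> X).
Hypothesis at_mk : forall a c, at_ (mk a c) = a.
Hypothesis co_mk : forall a c, co (mk a c) = c.
Hypothesis mkK : forall x, mk (at_ x) (co x) = x.
Hypothesis g_gt0 : 0 < g.
Hypothesis q_gt0 : 0 < q.
Hypothesis qm : 2 * q < m.
Hypothesis qg_gt1 : 1 < q * g.
Local Notation F0 := (base_family q at_).
Let c0 : 'I_g := Ordinal g_gt0.

Definition three_points : {set X} := [set mk (inord i) c0 | i : 'I_3].

Lemma card_three_points : #|three_points| = 3.
Proof.
rewrite card_imset ?card_ord // => i j /(congr1 at_); rewrite !at_mk.
move=> /(congr1 (@nat_of_ord m)); have i3 := ltn_ord i; have j3 := ltn_ord j.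
by rewrite !inordK; [move/ord_inj|lia|lia].
Qed.

(** A symmetry that permutes only these three points fixes all atoms: if [1 < g], each
atom contains a point that stays fixed, and if [g = 1], a dihedral symmetry that
fixes the atoms 3 and 4 is the identity. *)
Lemma three_points_stab s :
  perm_on three_points s -> s \in family_stab F0 -> s = 1%g.
Proof.
move=> sS sF; have [u su uW] := stab_lift_wreath at_mk co_mk mkK g_gt0
  (windows_separate q_gt0 qm) sF.
have at_s (x : X) : at_ (s x) = u.1 (at_ x) by rewrite su permE /wreath_fun at_mk.
have fixed (a : 'I_m) (c : 'I_g) : (c != c0) || (2 < a) -> u.1 a = a.
  move=> ac; have : mk a c \notin three_points.
    apply/imsetP => -[i _ e]; have := congr1 co e; have := congr1 at_ e.
    rewrite !at_mk !co_mk => ea ec; move: ac; rewrite ec eqxx ea inordK.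
      by have := ltn_ord i; lia.
    by have := ltn_ord i; lia.
  by move=> /(out_perm sS) e; have := at_s (mk a c); rewrite e at_mk.
have u1 (a : 'I_m) : u.1 a = a.
  have [g1|g1] := ltnP 1 g.
    by apply: (@fixed a (Ordinal g1)); rewrite -val_eqE.
  have q1 : 1 < q by case: g g_gt0 g1 qg_gt1 => [|[|]] //; rewrite muln1.
  have [[e t] ue] := stab_dihedral q_gt0 qm q1 uW.
  have n2 : (2%:R : 'I_m)%R != 0%R by apply: natr_Zp_neq0; lia.
  have fix3 : u.1 3%:R%R = 3%:R%R.
    by apply: (@fixed _ c0); rewrite Zp_nat /= modn_small ?orbT //; lia.
  have fix4 : u.1 4%:R%R = 4%:R%R.
    by apply: (@fixed _ c0); rewrite Zp_nat /= modn_small ?orbT //; lia.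
  move: fix3 fix4; rewrite ue !permE /dihedral_fun /=; case: (e) => e3 e4.
    move: e4; rewrite -![4%:R%R]natr1 opprD addrA e3 => /addrI h.
    by case/eqP: n2; rewrite (natrD _ 1 1) -{1}h addNr.
  have t0 : t = 0%R by apply: (addIr 3%:R%R); rewrite e3 add0r.
  by rewrite t0 add0r.
apply/permP => x; rewrite perm1; have [xS|xS] := boolP (x \in three_points);
  last exact: out_perm sS xS.
have : s x \in three_points by rewrite perm_closed.
have := at_s x; rewrite u1; case/imsetP: xS => i _ -> e /imsetP[j _ e'].
by rewrite e'; move: e; rewrite e' !at_mk => ->.
Qed.
End ThreePoints.

(** * Wreaths on residues as windows *)

Section Transport.
Variables (N p q g k : nat).
Local Notation m := p.+2.
Local Notation n := N.+2.
Hypothesis nE : n = m * g.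
Hypothesis kE : k = q * g.
Hypothesis g_gcd : gcdn n k = g.
Hypothesis q_gt0 : 0 < q.
Hypothesis qm : 2 * q < m.
Hypothesis g_gt0 : 0 < g.

(** Positions are counted from [x - 1], since the blocks of a wreath start at positions
that are 1 modulo [k]. *)
Definition atom (x : 'I_n) : 'I_m := inord (nat_of_ord (x - 1)%R %/ g).
Definition slot (x : 'I_n) : 'I_g := Ordinal (ltn_pmod (nat_of_ord (x - 1)%R)
  g_gt0).
Definition point (a : 'I_m) (c : 'I_g) : 'I_n := (1 + (a * g + c)%:R)%R.

Lemma val_point a c : nat_of_ord (point a c - 1)%R = a * g + c.
Proof.
rewrite /point addrC addKr Zp_nat /= modn_small //.
have := ltn_ord a; have := ltn_ord c; rewrite nE => cg am.
by apply: (@leq_trans (a.+1 * g)); rewrite ?leq_mul2r ?am ?orbT // mulSn addnC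
  ltn_add2r.
Qed.

Lemma atom_point a c : atom (point a c) = a.
Proof. by apply/ord_inj; rewrite /atom val_point divnMDl // divn_small // addn0
  inord_val. Qed.

Lemma slot_point a c : slot (point a c) = c.
Proof.
apply/ord_inj.
rewrite (_ : nat_of_ord (slot _) = nat_of_ord (point a c - 1)%R %% g) //.
by rewrite val_point modnMDl modn_small.
Qed.

Lemma pointK x : point (atom x) (slot x) = x.
Proof.
apply: (addIr (-1)%R); apply/ord_inj; rewrite val_point /atom inordK.
  by rewrite /= -divn_eq.
by rewrite ltn_divLR // -nE ltn_ord.
Qed.

(** The left side consists of [q * g] consecutive positions starting at the beginning
of the atom [a]. *)
Lemma block_atom (a : 'I_m) :
  [set ((a * g)%:R + j.+1%:R)%R | j : 'I_k] = atom @^-1: window q a :> {set 'I_n}.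
Proof.
have kn : k < n.
  by rewrite kE nE ltn_mul2r g_gt0 /=; lia.
apply/eqP; rewrite eqEcard; apply/andP; split.
  apply/subsetP => _ /imsetP[j _ ->]; rewrite inE.
  have -> : atom ((a * g)%:R + j.+1%:R)%R = (a + (j %/ g)%:R)%R.
    apply/ord_inj; rewrite /atom -natr1 addrA addrK -natrD Zp_nat /=.
    rewrite nE -modn_divl divnMDl // inordK ?ltn_mod //.
    by rewrite Zp_nat /= modnDmr.
  rewrite inE addrC addKr Zp_nat /= modn_small.
    by rewrite ltn_divLR // -kE.
  rewrite ltn_divLR // -nE; exact: ltn_trans kn.
rewrite (card_preim_at atom_point slot_point pointK) card_window // -kE.
rewrite card_imset ?card_ord // => i j /addrI /(congr1 (@nat_of_ord n)).
rewrite !Zp_nat /= !modn_small; first by case=> /ord_inj.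
  exact: leq_ltn_trans kn.
exact: leq_ltn_trans kn.
Qed.

(** Modulo [n] the multiples of [k] are the multiples of [g]. *)
Lemma wreath1 : wreath k (1%g : {perm 'Z_n}) = base_family q atom.
Proof.
have blockE (i : 'I_n) (a : 'I_m) : ((i - 1) * k%:R = (a * g)%:R)%R ->
    wreath_block k (1%g : {perm 'Z_n}) i = atom @^-1: window q a.
  move=> e; rewrite -block_atom; apply: eq_imset => j.
  by rewrite perm1 e.
apply/setP => A; apply/imsetP/idP => [[i _ ->]|].
  pose b : 'I_n := ((i - 1) * k%:R)%R.
  have ab : nat_of_ord b %/ g < m by rewrite ltn_divLR // -nE ltn_ord.
  have gb : g %| b.
    have gn : g %| n by rewrite nE dvdn_mull.
    rewrite /b Zp_nat /= /dvdn modn_dvdm // -modnMmr modn_dvdm // kE modnMl.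
    by rewrite muln0 mod0n.
  rewrite (@blockE i (Ordinal ab)); first exact: block_base.
  have -> : Ordinal ab * g = b by rewrite -[RHS](divnK gb).
  by rewrite natr_Zp.
case/mem_base => a ->.
have k_gt0 : 0 < k by rewrite kE muln_gt0 q_gt0.
have [u v uv _] := egcdnP n k_gt0.
exists (1 + (a * u)%:R)%R => //; apply/esym/blockE.
rewrite addrC addKr -natrM -mulnA uv gcdnC g_gcd mulnDr natrD mulnA natrM.
by rewrite (_ : n%:R = 0)%R ?mulr0 ?add0r //; apply/ord_inj;
  rewrite Zp_nat /= modnn.
Qed.

Lemma wreathE (pi : {perm 'Z_n}) : wreath k pi = move pi (base_family q atom).
Proof.
rewrite -wreath1 /move /wreath -imset_comp; apply: eq_imset => i /=.
by rewrite /wreath_block -imset_comp; apply: eq_imset => j /=; rewrite perm1.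
Qed.

Lemma wreathsE : wreaths n k = family_orbit (base_family q atom).
Proof. by apply: eq_imset => pi; exact: wreathE. Qed.
End Transport.

(** * The spectrum of the wreath matrix *)

Local Open Scope ring_scope.

(** Makes the listed multiplicities positive. *)
Lemma bin_pred_lt n l : (0 < l)%N -> (2 * l <= n)%N -> ('C(n, l.-1) < 'C(n, l))%N.
Proof.
case: l => // l _ ln /=; rewrite -(ltn_pmul2l (ltn0Sn l)) mul_bin_left.
by rewrite ltn_pmul2r ?bin_gt0; lia.
Qed.

Section Final.
Variables (R : numFieldType) (N p q g k : nat).
Local Notation m := p.+2.
Local Notation n := N.+2.
Hypothesis nE : n = (m * g)%N.
Hypothesis kE : k = (q * g)%N.
Hypothesis g_gcd : gcdn n k = g.
Hypothesis q_gt0 : (0 < q)%N.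
Hypothesis qm : (2 * q < m)%N.
Hypothesis g_gt0 : (0 < g)%N.

Local Notation at_ := (@atom N p g).
Local Notation F0 := (base_family q at_).
Local Notation M := (wreath_matrix R n k).

Let at_mk := @atom_point N p g nE g_gt0.
Let co_mk := @slot_point N p g nE g_gt0.
Let mkK := @pointK N p g nE g_gt0.

(** The eigenvalue [theta k F0 1], which vanishes, is skipped: [theta k F0 0] is listed
as the first one. *)
Definition wreath_eigenvalue l : int :=
  if l is 0 then 0 else if l is 1 then theta k F0 0 else theta k F0 l.

Let base_k A : A \in F0 -> #|A| = k.
Proof. by rewrite kE; exact: (base_card at_mk co_mk mkK q_gt0 qm). Qed.

Let n_small : (2 * k <= #|'I_n|)%N.
Proof. by rewrite kE; exact: (model_small at_mk co_mk mkK qm). Qed.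

Let theta1 : theta k F0 1 = 0.
Proof. by rewrite kE; exact: (model_theta1 at_mk co_mk mkK g_gt0 q_gt0 qm). Qed.

Let theta_pos l : (2 <= l <= k)%N -> 0 < theta k F0 l <= theta k F0 0.
Proof. by rewrite kE; exact: (model_theta_gt0 at_mk co_mk mkK g_gt0 q_gt0 qm). Qed.

Let theta0_pos : 0 < theta k F0 0.
Proof. by rewrite kE; exact: (model_theta0_gt0 at_mk co_mk mkK g_gt0 q_gt0 qm). Qed.

Let k_gt0 : (0 < k)%N. Proof. by rewrite kE muln_gt0 q_gt0. Qed.

Lemma rank_wreath_eigenspace (a : R) : a != 0 ->
  \rank (eigenspace M a)
  = (\sum_(1 <= l < k.+1 | ((wreath_eigenvalue l)%:~R : R) == a) wreath_mult n l)%N.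
Proof.
move=> a0; rewrite (_ : M = intersection_mx R (wreaths n k)) //.
rewrite (wreathsE nE kE g_gcd q_gt0 qm g_gt0) (rank_eigenspace_intersection
  base_k n_small) //.
rewrite -(big_mkord (fun l => (theta k F0 l)%:~R == a) (layer_dim 'I_n)).
rewrite big_ltn_cond // big_ltn_cond // theta1 [0%:~R == a]eq_sym (negbTE a0).
rewrite [RHS]big_ltn_cond //=.
have e : (\sum_(2 <= i < k.+1 | (theta k F0 i)%:~R == a) layer_dim 'I_n i
  = \sum_(2 <= i < k.+1 | (wreath_eigenvalue i)%:~R == a) wreath_mult n i)%N.
  rewrite big_nat_cond [RHS]big_nat_cond; apply: eq_big => [[|[|i]]|[|[|i]]] //.
  by rewrite /layer_dim card_ord.
by rewrite e.
Qed.

Lemma wreath_eigenvalueP (a : R) : eigenvalue M a ->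
  exists2 l : nat, (l <= k)%N & a = (wreath_eigenvalue l)%:~R.
Proof.
have [-> _|a0] := eqVneq a 0; first by exists 0%N.
rewrite /eigenvalue -mxrank_eq0 rank_wreath_eigenspace // big_mkcond.
rewrite big_add1 big_mkord.
case: (pickP (fun l : 'I_k => (wreath_eigenvalue l.+1)%:~R == a)) => [l /eqP<-
  _|no].
  by exists l.+1 => //; apply: ltn_ord.
by rewrite big1 // => l _; have := no l => /= ->.
Qed.

Lemma wreath_mult_gt0 l : (0 < l <= k)%N -> (0 < wreath_mult n l)%N.
Proof.
case/andP=> l0 lk; rewrite /wreath_mult; case: eqP => // _.
rewrite subn_gt0 bin_pred_lt //; have := n_small; rewrite card_ord; lia.
Qed.

Lemma wreath_eigenvalue_gt0 l : (0 < l <= k)%N -> 0 < wreath_eigenvalue l.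
Proof.
case: l => [|[|l]] lk; first by [].
  exact theta0_pos.
by have /andP[] := @theta_pos l.+2 lk.
Qed.

Lemma wreath_eigenvalue_le l : (2 <= l <= k)%N ->
  0 < wreath_eigenvalue l <= wreath_eigenvalue 1.
Proof. by case: l => [|[|l]] //; exact: theta_pos. Qed.

Lemma wreath_eigenvalue_eigenvalue l : (l <= k)%N -> (0 < l)%N || (1 < k)%N ->
  eigenvalue M (wreath_eigenvalue l)%:~R.
Proof.
case: l => [_ k1|l lk _].
  rewrite (_ : M = intersection_mx R (wreaths n k)) //.
  rewrite (wreathsE nE kE g_gcd q_gt0 qm g_gt0).
  have qg1 : (1 < q * g)%N by rewrite -kE.
  apply: (eigenvalue0 base_k (S := three_points (@point N p g) g_gt0)).
    by move=> s; apply: (three_points_stab at_mk co_mk mkK q_gt0 qm qg1).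
  by rewrite (card_three_points at_mk g_gt0 q_gt0 qm).
have lam0 : ((wreath_eigenvalue l.+1)%:~R : R) != 0.
  by rewrite intr_eq0 gt_eqF // wreath_eigenvalue_gt0.
rewrite /eigenvalue -mxrank_eq0 rank_wreath_eigenspace // -lt0n.
rewrite big_add1 big_mkord (bigD1 (Ordinal lk)) //= addn_gt0.
by rewrite wreath_mult_gt0.
Qed.

(** The number of pairs of blocks times the number of permutations mapping one block to
a given [k]-subset, divided by the size of the stabilizer. *)
Lemma wreath_eigenvalue1 :
  (wreath_eigenvalue 1)%:~R =
          (if (k %| n)%N then
             (n ^ 2 * (n - k)`!)%:R
             / (k ^ 2 * k`! ^ (n %/ k - 1) * (n %/ k)`!)%:R
           else
             (n * (n - k)`! * k`!)%:R / (2 * g * g`! ^ (n %/ g))%:R) :> R.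
Proof.
have := model_theta0 at_mk co_mk mkK g_gt0 q_gt0 qm; rewrite -nE -kE.
rewrite (card_stab_lift at_mk co_mk mkK g_gt0 (windows_separate q_gt0 qm)) card_ord.
rewrite /= -pmulrn; set h := superset_profile _ _ _ _ => e.
have ng : (n %/ g = m)%N by rewrite nE mulnK.
have [kn|kn] := boolP (k %| n)%N.
  have q1 : q = 1%N.
    have : (k %| g)%N by rewrite -g_gcd dvdn_gcd kn dvdnn.
    by rewrite kE => /(dvdn_leq g_gt0); rewrite -{2}[g]mul1n leq_mul2r; lia.
  have kg : k = g by rewrite kE q1 mul1n.
  move: e; rewrite q1 card_window1_stab -kg => e.
  have nk : (n %/ k = m)%N by rewrite kg.
  have D_neq0 : ((k ^ 2 * k`! ^ (m - 1) * m`!)%:R : R) != 0.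
    by rewrite pnatr_eq0 -lt0n !muln_gt0 !expn_gt0 !fact_gt0 k_gt0.
  rewrite nk; apply: (canRL (mulfK D_neq0)); rewrite -natrM; congr (_ *+ _).
  apply/eqP; rewrite -(eqn_pmul2l (fact_gt0 k)); apply/eqP.
  transitivity (m`! * k`! ^ m * h * k ^ 2)%N.
    by rewrite subn1 /= [in RHS]expnS; ring.
  have -> : (n ^ 2 = m ^ 2 * k ^ 2)%N by rewrite nE -kg expnMn.
  by rewrite e; ring.
have q1 : (1 < q)%N.
  rewrite ltn_neqAle q_gt0 andbT eq_sym; apply: contra kn => /eqP q1.
  by rewrite kE q1 mul1n nE dvdn_mull.
move: e; rewrite card_window_stab // ng => e.
have D_neq0 : ((2 * g * g`! ^ m)%:R : R) != 0.
  by rewrite pnatr_eq0 -lt0n muln_gt0 expn_gt0 fact_gt0 muln_gt0 g_gt0.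
apply: (canRL (mulfK D_neq0)); rewrite -natrM; congr (_ *+ _).
apply/eqP; rewrite -(eqn_pmul2l (ltn0Sn p.+1)); apply/eqP.
transitivity (2 * m * g`! ^ m * h * g)%N; first by ring.
have -> : (n * (n - k)`! * k`! = m * g * ((n - k)`! * k`!))%N by rewrite -nE mulnA.
by rewrite e; ring.
Qed.

End Final.

Lemma wreath_eigenvalue_coprime (R : numFieldType) (N p q g k l : nat) :
    N.+2 = (p.+2 * g)%N -> k = (q * g)%N -> (2 * q < p.+2)%N ->
    g = 1%N -> (2 <= l <= k)%N ->
        (wreath_eigenvalue N p q g k l)%:~R =
          (-1) ^+ l * (1 / 2) * (l`!)%:R * (k`!)%:R * ((N.+2 - k - l)`!)%:R
            * (N.+2%:R - 2 * k%:R - 1) * 'C(k, l)%:R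
          - (1 / 2) * (k`!)%:R * ((N.+2 - k)`!)%:R
          + (l`!)%:R * 'C(k.+1, l.+1)%:R
            * \sum_(0 <= j < l.+1)
                (-1) ^+ (l - j) * ((k - j)`!)%:R * ((N.+2 - k - l + j)`!)%:R :> R.
Proof.
move=> nE kE qm g1; subst g.
have kq : k = q by rewrite kE muln1.
have Np : N = p by move: nE; rewrite muln1 => -[].
clear kE; subst k N; move=> lq; have q1 : (1 < q)%N by lia.
rewrite -(coprime_theta (atom_point nE (ltn0Sn 0)) (slot_point nE (ltn0Sn 0))
  (pointK nE (ltn0Sn 0))) //.
by case: l lq => [|[|]].
Qed.


Theorem theorem1p5 (R : numFieldType) (n k : nat)
    (k_gt0 : (0 < k)%N) (k_lt : (2 * k < n)%N) :
  let g := gcdn n k in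
  let M := wreath_matrix R n k in
  exists lam : nat -> int,
    [/\ (* lambda_0 = 0, lambda_1 > 0 and lambda_1 >= lambda_l > 0 *)
        [/\ lam 0%N = 0, 0 < lam 1%N
          & forall l : nat, (2 <= l <= k)%N -> 0 < lam l <= lam 1%N],
        (* the eigenvalues of M are lambda_0, ..., lambda_k; for k = 1 the
           matrix is the 1 x 1 matrix (n), for which 0 has multiplicity 0 *)
        (forall a : R, eigenvalue M a ->
           exists2 l : nat, (l <= k)%N & a = (lam l)%:~R)
        /\ (forall l : nat, (l <= k)%N -> (0 < l)%N || (1 < k)%N ->
              eigenvalue M (lam l)%:~R),
        (* multiplicities of the nonzero eigenvalues, adding up coincidences *)
        forall a : R, a != 0 ->
          \rank (eigenspace M a)
          = (\sum_(1 <= l < k.+1 | ((lam l)%:~R : R) == a) wreath_mult n l)%N,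
        (lam 1%N)%:~R =
          (if (k %| n)%N then
             (n ^ 2 * (n - k)`!)%:R
             / (k ^ 2 * k`! ^ (n %/ k - 1) * (n %/ k)`!)%:R
           else
             (n * (n - k)`! * k`!)%:R / (2 * g * g`! ^ (n %/ g))%:R) :> R
      & g = 1%N -> forall l : nat, (2 <= l <= k)%N ->
        (lam l)%:~R =
          (-1) ^+ l * (1 / 2) * (l`!)%:R * (k`!)%:R * ((n - k - l)`!)%:R
            * (n%:R - 2 * k%:R - 1) * 'C(k, l)%:R
          - (1 / 2) * (k`!)%:R * ((n - k)`!)%:R
          + (l`!)%:R * 'C(k.+1, l.+1)%:R
            * \sum_(0 <= j < l.+1)
                (-1) ^+ (l - j) * ((k - j)`!)%:R * ((n - k - l + j)`!)%:R :> R].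
Proof.
move=> g M.
have g_gt0 : (0 < g)%N by rewrite gcdn_gt0 k_gt0 orbT.
have [q kE] : exists q, k = (q * g)%N by exists (k %/ g)%N; rewrite divnK ?dvdn_gcdr.
have [m nE] : exists m, n = (m * g)%N by exists (n %/ g)%N; rewrite divnK ?dvdn_gcdl.
have q_gt0 : (0 < q)%N by move: k_gt0; rewrite kE muln_gt0 => /andP[].
have qm : (2 * q < m)%N by move: k_lt; rewrite {1}kE {1}nE mulnA ltn_mul2r => /andP[].
case: m nE qm => [|[|p]] nE qm; [lia|lia|].
move: @g @M g_gt0 kE nE k_lt; case: n => [|[|N]] g M g_gt0 kE nE k_lt; [lia|lia|].
exists (wreath_eigenvalue N p q g k); split.
- split=> //; first exact: (wreath_eigenvalue_gt0 nE kE).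
  exact: (wreath_eigenvalue_le nE kE).
- split; first exact: (wreath_eigenvalueP nE kE).
  exact: (wreath_eigenvalue_eigenvalue R nE kE).
- exact: (rank_wreath_eigenspace nE kE).
- exact: (wreath_eigenvalue1 R nE kE).
- by move=> g1 l; apply: wreath_eigenvalue_coprime.
Qed.
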